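(* Let $P$ and $Q$ be finite posets with isomorphic comparability graphs, and let $q$ be a positive integer. Then there is a cardinality-preserving bijection between the set of $K$-promotion orbits of $\mathrm{Inc}^q(P)$ and the set of $K$-promotion orbits of $\mathrm{Inc}^q(Q)$.
   Context: The comparability graph of a poset $P$ is the graph whose vertices are the elements of $P$, with two distinct vertices adjacent if and only if they are comparable in $P$; isomorphism is isomorphism of graphs. Let $[q]=\{1,\dots,q\}$. For a finite poset $P$, $\mathrm{Inc}^q(P)$ is the set of increasing tableaux of height $q$ on $P$, i.e. maps $T:P\to[q]$ with $T(x)<T(y)$ whenever $x<y$ in $P$. $K$-promotion $\psi:\mathrm{Inc}^q(P)\to\mathrm{Inc}^q(P)$ is defined as follows. Start with $T\in\mathrm{Inc}^q(P)$. For $i=2,3,\dots,q$ in succession: consider the elements of $P$ currently labeled $1$ or $i$, and the connected components of the subgraph of the Hasse diagram of $P$ induced on these elements; in each component with more than one element, swap the labels $1$ and $i$ (elements labeled $1$ become labeled $i$ and vice versa); leave one-element components unchanged. After step $i=q$, decrease every label by $1$, and replace every resulting label $0$ by $q$. The result is $\psi(T)\in\mathrm{Inc}^q(P)$. The map $\psi$ is a bijection; its orbits are the $K$-promotion orbits. *)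

(* Defs.v *)
From mathcomp Require Import all_boot all_order perm.
From mathcomp Require Import zify.

Set Implicit Arguments.
Unset Strict Implicit.
Unset Printing Implicit Defensive.

Import Order.TTheory.
Local Open Scope order_scope.

Section Comparability.

Definition comparability {d : Order.disp_t} (P : finPOrderType d) : rel P :=
  [rel x y | (x != y) && (x >=< y)].

Definition comparability_isomorphic {d d' : Order.disp_t}
    (P : finPOrderType d) (Q : finPOrderType d') : Prop :=
  exists2 g : P -> Q, bijective g &
    forall x y, comparability (g x) (g y) = comparability x y.

End Comparability.

Section KPromotion.

Context {d : Order.disp_t} (P : finPOrderType d) (q : nat).

(* The labels 1, ..., q are the nonzero elements of 'I_q.+1; Inc excludes 0. *)
Definition labeling : finType := {ffun P -> 'I_q.+1}.

Implicit Types (T : labeling) (i : 'I_q.+1) (x y z : P).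

Definition Inc : {set labeling} :=
  [set T : labeling | [forall x, (0 < T x)%N] &&
    [forall x, forall y, (x < y) ==> (T x < T y)%N]].

Definition cover_rel : rel P :=
  [rel x y | (x < y) && ~~ [exists z, (x < z) && (z < y)]].

Definition hasse : rel P := [rel x y | cover_rel x y || cover_rel y x].

(* The label 1; this is the intended element of 'I_q.+1 only if 0 < q. *)
Definition one : 'I_q.+1 := inord 1.

Definition labeled T i : {set P} := [set x | (T x == one) || (T x == i)].

(* The component of x in the subgraph of the Hasse diagram induced on the
   elements labeled 1 or i; it is {x} when x has another label. *)
Definition component T i x : {set P} :=
  [set y | connect [rel u v | [&& u \in labeled T i, v \in labeled T i
                                & hasse u v]] x y].

(* tperm one i exchanges the labels 1 and i and fixes all the others. *)
Definition kstep T i : labeling :=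
  [ffun x => if (1 < #|component T i x|)%N then tperm one i (T x) else T x].

Definition kshift T : labeling :=
  [ffun x => if (T x).-1 == 0%N then ord_max else inord (T x).-1].

(* The enumeration of 'I_q.+1 is increasing, so that i = 2, 3, ..., q in turn. *)
Definition kpromotion T : labeling :=
  kshift (foldl kstep T [seq i : 'I_q.+1 <- enum 'I_q.+1 | (1 < i)%N]).

(* If 0 < q, then by kpromotion_Inc and kpromotion_inj below, kpromotion
   permutes the finite set Inc, so its forward orbits on Inc are its orbits. *)
Definition korbit T : {set labeling} := [set U in orbit kpromotion T].

Definition korbits : {set {set labeling}} := [set korbit T | T in Inc].

Lemma labeled_kstep T i : labeled (kstep T i) i = labeled T i.
Proof.
apply/setP=> x; rewrite !inE ffunE; case: ifP => // _.
by case: tpermP => [->|->|]; rewrite ?eqxx ?orbT // => /eqP/negPf -> /eqP/negPf ->.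
Qed.

Lemma kstepK i : involutive (kstep^~ i).
Proof.
move=> T; apply/ffunP=> x; rewrite !ffunE.
have -> : component (kstep T i) i x = component T i x.
  by rewrite /component labeled_kstep.
by case: (1 < _)%N; rewrite ?tpermK.
Qed.

Lemma foldl_kstep_inj (s : seq 'I_q.+1) : injective (fun T => foldl kstep T s).
Proof.
elim: s => [|i s IHs] T U //= /IHs; exact: (can_inj (kstepK i)).
Qed.

(* Once the labels 2, ..., k have been treated, the labels are increasing for
   the order 2 < ... < k < 1 < k.+1 < ... < q. *)
Let rank (k v : nat) : nat := if v == 1%N then k.*2.+1 else v.*2.

Let ranked (k : nat) T : Prop :=
  (forall x, (0 < T x)%N) /\
  (forall x y, x < y -> (rank k (T x) < rank k (T y))%N).

Lemma rank_kstep i T :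
  (0 < q)%N -> (1 < i)%N -> ranked i.-1 T -> ranked i (kstep T i).
Proof.
move=> q0 i1 [T0 Tinc]; have one1 : one = 1%N :> nat by rewrite inordK.
have S0 x : (0 < kstep T i x)%N.
  by rewrite ffunE; case: ifP => // _; case: tpermP => // _; rewrite ?one1 // ltnW.
split=> // x y xy.
have rE v : rank i.-1 v = (if v == 1%N then i.*2.-1 else v.*2).
  by rewrite /rank; case: ifP => // _; lia.
have S x0 : x0 \notin labeled T i -> kstep T i x0 = T x0.
  rewrite !inE negb_or => /andP[h1 h2]; rewrite ffunE; case: ifP => // _.
  by rewrite tpermD // eq_sym.
have SL x0 : x0 \in labeled T i -> kstep T i x0 \in [:: one; i].
  by rewrite -(labeled_kstep T i) !inE.
have := Tinc x y xy; rewrite !rE.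
case: (boolP (x \in labeled T i)) => xL; case: (boolP (y \in labeled T i)) => yL.
- move=> lt_xy.
  have [Tx Ty] : T x = one /\ T y = i.
    by move: xL yL lt_xy; rewrite !inE => /orP[]/eqP-> /orP[]/eqP->;
      rewrite ?one1 ?eqxx; move=> h; split=> //; exfalso; move: h; do ?case: eqP; lia.
  have cov : cover_rel x y.
    rewrite /cover_rel /= xy /=; apply/existsP=> -[z /andP[xz zy]].
    move: (Tinc x z xz) (Tinc z y zy); rewrite !rE Tx Ty one1 eqxx.
    by do ?case: eqP; lia.
  have nxy : x != y by rewrite lt_eqF.
  have edge u v : (u \in [:: x; y]) -> (v \in [:: x; y]) -> hasse u v ->
      v \in component T i u.
    move=> ul vl huv; rewrite inE; apply: connect1 => /=; rewrite huv andbT.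
    by move: ul vl; rewrite !inE => /orP[]/eqP-> /orP[]/eqP->;
      rewrite ?Tx ?Ty ?eqxx ?orbT.
  have big u v : u != v -> v \in component T i u -> (1 < #|component T i u|)%N.
    move=> uv vu; rewrite (cardD1 u) (cardD1 v) !inE connect0.
    by move: vu; rewrite !inE eq_sym uv => ->.
  rewrite !ffunE (big x y) ?(big y x) ?Tx ?Ty ?tpermL ?tpermR ?(eq_sym y) //.
  + by rewrite /rank one1 eqxx; do ?case: eqP; lia.
  + by apply: edge; rewrite ?inE ?eqxx ?orbT //= /hasse /= cov ?orbT.
  + by apply: edge; rewrite ?inE ?eqxx ?orbT //= /hasse /= cov ?orbT.
- rewrite (S y yL); have Sx := SL x xL; move: Sx yL xL (T0 y); rewrite !inE.
  rewrite /rank -!val_eqE /= one1.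
  by move=> /orP[]/eqP-> /norP[/negPf-> /eqP yi] /orP[]/eqP->; rewrite ?eqxx;
    do ?case: eqP; lia.
- rewrite (S x xL); have Sy := SL y yL; move: Sy yL xL (T0 x); rewrite !inE.
  rewrite /rank -!val_eqE /= one1.
  by move=> /orP[]/eqP-> /orP[]/eqP-> /norP[/negPf-> /eqP yi]; rewrite ?eqxx;
    do ?case: eqP; lia.
- rewrite !S //; move: xL yL; rewrite !inE -!val_eqE /= one1 /rank.
  by move=> /norP[/negPf-> _] /norP[/negPf-> _].
Qed.

Lemma ranked_foldl T : (0 < q)%N -> T \in Inc ->
  ranked q (foldl kstep T [seq i : 'I_q.+1 <- enum 'I_q.+1 | (1 < i)%N]).
Proof.
move=> q0; rewrite inE => /andP[/forallP T0 /forallP Tinc].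
have T1 : ranked 1 T.
  split=> // x y xy; have /forallP/(_ y)/implyP/(_ xy) := Tinc x.
  by move: (T0 x) (T0 y); rewrite /rank; do ?case: eqP; lia.
pose s := [seq i : 'I_q.+1 <- enum 'I_q.+1 | (1 < i)%N].
have Es : map val s = iota 2 q.-1.
  have -> : s = filter (preim val (fun j => (1 < j)%N)) (enum 'I_q.+1) by [].
  rewrite -filter_map val_enum_ord.
  case: (q) q0 => // n _; rewrite /= (@eq_in_filter _ _ predT) ?filter_predT //.
  by move=> j; rewrite mem_iota => /andP[->].
have gen (t : seq 'I_q.+1) U k : map val t = iota k.+1 (size t) -> (0 < k)%N ->
    ranked k U -> ranked (k + size t) (foldl kstep U t).
  elim: t U k => [|i t IHt] U k /=; first by rewrite addn0.
  case=> ik Et k0 Uk; rewrite addnS -addSn; apply: IHt => //.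
  by rewrite -ik; apply: rank_kstep; rewrite ?ik.
have ss : size s = q.-1 by rewrite -(size_map val) Es size_iota.
by have := gen s T 1%N; rewrite ss Es add1n prednK //; apply.
Qed.

Let kshiftE T x : (0 < T x)%N ->
  kshift T x = (if T x == 1%N :> nat then q else (T x).-1) :> nat.
Proof.
move=> T0; rewrite ffunE; have := ltn_ord (T x).
move: (T x : nat) T0 => v v0 vq.
have -> : (v.-1 == 0%N) = (v == 1%N) by lia.
by case: ifP => //= _; rewrite inordK //; lia.
Qed.

Lemma kpromotion_Inc T : (0 < q)%N -> T \in Inc -> kpromotion T \in Inc.
Proof.
move=> q0 /(ranked_foldl q0); rewrite /kpromotion.
set U := foldl _ _ _ => -[U0 Uinc]; rewrite inE; apply/andP; split.
  by apply/forallP=> x; rewrite kshiftE //; have := U0 x; case: eqP; lia.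
apply/forallP=> x; apply/forallP=> y; apply/implyP=> xy.
have := Uinc x y xy; rewrite !kshiftE // /rank.
by move: (ltn_ord (U x)) (ltn_ord (U y)) (U0 x) (U0 y); do ?case: eqP; lia.
Qed.

Lemma kpromotion_inj : (0 < q)%N -> {in Inc &, injective kpromotion}.
Proof.
move=> q0 T U /(ranked_foldl q0)[T0 _] /(ranked_foldl q0)[U0 _] eqTU.
apply: (@foldl_kstep_inj [seq i : 'I_q.+1 <- enum 'I_q.+1 | (1 < i)%N]).
apply/ffunP=> x; apply: val_inj => /=.
have := congr1 (fun V : labeling => V x : nat) eqTU.
rewrite /kpromotion /= !kshiftE //; move: (T0 x) (U0 x).
set t := foldl _ T _ x; set u := foldl _ U _ x.
move: (ltn_ord t) (ltn_ord u); move: (t : nat) (u : nat) => {}t {}u.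
by do ?case: eqP; lia.
Qed.

End KPromotion.

(* Main.v *)
Require Import Defs.
From mathcomp Require Import all_boot all_order.
From mathcomp Require Import perm zify.

(* Both posets may be carried by the same set V. Two orders r, s on V with the
   same comparability graph are joined by reversals of autonomous sets: colour
   a pair of elements by "incomparable", "r and s agree" or "r and s disagree".
   There are no rainbow triangles, so by Gallai one of the colours does not
   connect V, and each of the three cases reduces to smaller autonomous sets.

   K-promotion is a product of the K-Bender-Knuth involutions exchanging i and
   i + 1, for i = 1, ..., q - 1. Let M be autonomous, and describe a tableau T
   by its skeleton (T outside M, and the set of labels used on M) and its pack
   (the relative order of the labels on M). The involutions act on the
   skeleton independently of the pack and of the direction of M; on the pack,
   K-promotion does nothing or acts by the gapless K-promotion of M, as decided
   by the skeleton. Reversing the labels on M within the set of labels conjugates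
   the gapless K-promotion of the dual of M to the inverse of that of M. Since a
   power of a permutation fixes the same points as its inverse, this reversal
   preserves the size of every orbit. *)

Set Implicit Arguments.
Unset Strict Implicit.
Unset Printing Implicit Defensive.

(** * Colourings without rainbow triangles *)

Section GallaiColouring.

Context {V : finType} {K : eqType} (c : V -> V -> K).
Hypothesis c_sym : forall x y, c x y = c y x.
Hypothesis c_rainbow : forall x y z,
  c x y != c y z -> (c x z == c x y) || (c x z == c y z).

(** The graph formed by the [k]-coloured pairs is disconnected on [X]. *)
Definition split_colour (k : K) (X : {set V}) : bool :=
  [exists Y : {set V}, [&& Y != set0, Y \proper X &
    [forall y in Y, forall z in X :\: Y, c y z != k]]].

Lemma split_colourP k (X Y : {set V}) y0 x0 :
  y0 \in Y -> x0 \in X -> x0 \notin Y -> Y \subset X ->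
  (forall y z, y \in Y -> z \in X -> z \notin Y -> c y z != k) ->
  split_colour k X.
Proof.
move=> y0Y x0X x0Y YX cY; apply/existsP; exists Y; apply/and3P; split.
- by apply/set0Pn; exists y0.
- by apply/properP; split=> //; exists x0.
- by apply/forall_inP=> y yY; apply/forall_inP=> z; rewrite inE => /andP[]; auto.
Qed.

Lemma split_colour_connect k (X : {set V}) (e := [rel x y | [&& x \in X, y \in X & c x y == k]]) u :
  u \in X -> split_colour k X -> exists2 w, w \in X & ~~ connect e u w.
Proof.
move=> uX /existsP[Y /and3P[/set0Pn[y yY] /properP[YX [x xX xY]] cY]].
have clY : closed e Y.
  apply: intro_closed; first by apply: sym_connect_sym => a b /=; rewrite c_sym andbCA.
  move=> a b /= /and3P[aX bX cab] aY; apply/negPn/negP => bY.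
  have /forall_inP/(_ a aY)/forall_inP/(_ b) := cY.
  by rewrite !inE bX bY cab => /(_ isT).
case: (boolP (u \in Y)) => uY.
  exists x => //; apply/negP => /(closed_connect clY).
  by rewrite uY (negPf xY).
exists y; first exact: (subsetP YX).
by apply/negP => /(closed_connect clY); rewrite yY (negPf uY).
Qed.

(** Suppose that [a] connects [X]. If [v] has no edge of colour [b], or none of colour [n], then
    [[set v]] splits off. Otherwise the [b]-edge and the [n]-edge at [v] force two colours between
    the same two [a]-components of [X :\ v]. *)
Lemma split_colour_step a b n v (X : {set V}) : a != b -> a != n -> b != n ->
  v \in X -> split_colour a (X :\ v) ->
  [|| split_colour a X, split_colour b X | split_colour n X].
Proof.
move=> ab an bn vX sa; rewrite -implyNb; apply/implyP => nsa.
have one_colour k : ~~ [exists u in X :\ v, c v u == k] -> split_colour k X.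
  move=> none; have [Y /and3P[/set0Pn[y yY] /properP[YX _] _]] := existsP sa.
  have /setD1P[yv yX] := subsetP YX _ yY.
  apply: (@split_colourP k X [set v] v y); rewrite ?inE ?sub1set //.
  move=> _ z /set1P-> zX; rewrite inE => zv.
  by apply: contra none => cvz; apply/existsP; exists z; rewrite !inE zv zX.
apply/orP; case: (boolP [exists u in X :\ v, c v u == b]); last by left; apply: one_colour.
case/exists_inP=> u uX /eqP cvu; right; apply: one_colour; apply/negP.
case/exists_inP=> u' u'X /eqP cvu'.
pose e := [rel x y | [&& x \in X :\ v, y \in X :\ v & c x y == a]].
have e_sym : connect_sym e.
  by apply: sym_connect_sym => x y /=; rewrite c_sym andbCA.
have in_comp w w0 : w \in X :\ v -> connect e w w0 -> w0 \in X :\ v.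
  move=> wX /connectP[p + ->].
  elim: p w wX => //= y p IHp w _ /andP[/and3P[_ yX _]]; exact: IHp.
(* An [a]-component of [X :\ v] without an [a]-edge to [v] would split off in [X], against [nsa]. *)
have reach w : w \in X :\ v -> exists2 w0, connect e w w0 & c v w0 = a.
  move=> wX; case: (boolP [exists w0, connect e w w0 && (c v w0 == a)]).
    by case/existsP=> w0 /andP[ww0 /eqP]; exists w0.
  move=> none; case/negP: nsa.
  apply: (@split_colourP a X [set y | connect e w y] w v); rewrite ?inE //.
  - by apply/negP => /(in_comp _ _ wX); rewrite !inE eqxx.
  - by apply/subsetP=> y; rewrite inE => /(in_comp _ _ wX) /setD1P[].
  move=> y z; rewrite !inE => wy zX wz; apply/negP => cyz.
  have [zv|zv] := eqVneq z v.
    by case/negP: none; apply/existsP; exists y; rewrite wy c_sym -zv.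
  case/negP: wz; apply: connect_trans (wy) (connect1 _) => /=.
  by rewrite cyz (in_comp _ _ wX wy) !inE zv zX.
(* Edges from [x] to this component never have colour [a], so in a triangle over an [a]-edge of the
   component the two sides at [x] have the same colour. *)
have mono w x y : w \in X :\ v -> x \in X :\ v -> ~~ connect e w x ->
    connect e w y -> c x y = c x w.
  move=> wX xX wx /connectP[p + ->].
  elim: p w wX wx => //= z p IHp w wX wx /andP[wz zp].
  have zx : ~~ connect e z x.
    by apply: contra wx; apply: connect_trans; apply: connect1.
  have /and3P[_ zX /eqP cwz] := wz.
  rewrite (IHp z) //; have := @c_rainbow x w z; rewrite cwz.
  have cx t : t \in X :\ v -> ~~ connect e t x -> c x t != a.
    move=> tX; apply: contra => ctx; apply: connect1 => /=.
    by rewrite tX xX c_sym.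
  by rewrite (negPf (cx _ zX zx)) orbF cx // => /(_ isT)/eqP.
have far k t w : k != a -> t \in X :\ v -> w \in X :\ v -> ~~ connect e t w ->
    c v t = k -> c v w = a -> c t w = k.
  move=> ka tX wX tw cvt cvw; have := @c_rainbow t v w.
  rewrite c_sym cvt cvw ka => /(_ isT)/orP[/eqP//|cta].
  by case/negP: tw; apply: connect1; rewrite /= tX wX.
have ba : b != a by rewrite eq_sym.
have na : n != a by rewrite eq_sym.
(* In one component: a vertex [w0] of another component receives [b] from [u] and [n] from [u'],
   against [mono]. *)
case: (boolP (connect e u u')) => uu'.
  have [w wX uw] := split_colour_connect uX sa.
  have [w0 ww0 cw0] := reach w wX.
  have w0X := in_comp _ _ wX ww0.
  have uw0 : ~~ connect e u w0.
    by apply: contra uw => /connect_trans; apply; rewrite e_sym.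
  have u'w0 : ~~ connect e u' w0 by apply: contra uw0; apply: connect_trans.
  have := mono u w0 u' uX w0X uw0 uu'.
  rewrite ![c w0 _]c_sym (far n) // (far b) // => nb.
  by rewrite nb eqxx in bn.
(* In different components: [mono] and [far] force both [b] and [n] on the pair [u], [u']. *)
have [w uw cw] := reach u uX; have [w' uw' cw'] := reach u' u'X.
have wX := in_comp _ _ uX uw; have w'X := in_comp _ _ u'X uw'.
have u'u : ~~ connect e u' u by rewrite e_sym.
have := mono u u' w uX u'X uu' uw; have := mono u' u w' u'X uX u'u uw'.
rewrite (far b u w') // ?(far n u' w) //; last 2 first.
- by apply: contra u'u => /connect_trans; apply; rewrite e_sym.
- by apply: contra uu' => /connect_trans; apply; rewrite e_sym.
by rewrite [c u' u]c_sym => <- bn'; rewrite bn' eqxx in bn.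
Qed.

(** Induction on the size, deleting one vertex at a time. On two vertices, every colour other than
    that of their only edge splits. *)
Lemma gallai_split k1 k2 k3 (X : {set V}) : k1 != k2 -> k1 != k3 -> k2 != k3 ->
  1 < #|X| -> [|| split_colour k1 X, split_colour k2 X | split_colour k3 X].
Proof.
move=> k12 k13 k23; have [m] := ubnP #|X|; elim: m X => // m IHm X Xm X1.
have /card_gt1P[v [u [vX uX vu]]] := X1.
have Xv := cardsD1 v X; rewrite vX in Xv.
have [X'1|X'1] := ltnP 1 #|X :\ v|.
  have k21 : k2 != k1 by rewrite eq_sym.
  have k31 : k3 != k1 by rewrite eq_sym.
  have k32 : k3 != k2 by rewrite eq_sym.
  have /or3P[] : [|| split_colour k1 (X :\ v), split_colour k2 (X :\ v)
                   | split_colour k3 (X :\ v)] by apply: IHm => //; lia.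
  - exact: split_colour_step.
  - by move/(split_colour_step k21 k23 k13 vX)/or3P => [] ->; rewrite ?orbT.
  - by move/(split_colour_step k31 k32 k12 vX)/or3P => [] ->; rewrite ?orbT.
have X2 : X :\ v = [set u].
  apply/esym/eqP; rewrite eqEcard sub1set !inE eq_sym vu uX cards1; lia.
have sv k : c v u != k -> split_colour k X.
  move=> cvu; apply: (@split_colourP k X [set v] v u); rewrite ?inE ?sub1set //.
    by rewrite eq_sym.
  move=> _ z /set1P-> zX; rewrite inE => zv.
  by have : z \in [set u]; [rewrite -X2 !inE zv | move/set1P->].
by have [cvu|/sv->//] := eqVneq (c v u) k1; rewrite (sv k2) ?orbT // cvu.
Qed.

End GallaiColouring.

(** * Orders with the same comparability graph *)

Section Flips.

Context {V : finType}.
Implicit Types (r s : rel V) (M X Y : {set V}).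

Definition strict_order r := irreflexive r /\ transitive r.

Definition same_comparability r s :=
  forall x y, r x y || r y x = s x y || s y x.

Definition autonomous M r := forall x y z,
  x \in M -> y \in M -> z \notin M -> r x z = r y z /\ r z x = r z y.

Definition subst_rel M s r : rel V :=
  fun x y => if (x \in M) && (y \in M) then s x y else r x y.

Definition flip M r : rel V := subst_rel M (fun x y => r y x) r.

Definition disagree r s : rel V := fun x y => r x y && s y x || r y x && s x y.

Arguments subst_rel M s r x y /.
Arguments flip M r x y /.
Arguments disagree r s x y /.

Lemma asym r x y : strict_order r -> r x y -> r y x = false.
Proof. by case=> irr tr xy; apply: contraFF (irr x) => /(tr _ _ _ xy). Qed.

Lemma strict_order_rev r : strict_order r -> strict_order (fun x y => r y x).
Proof. by case=> irr tr; split=> // y x z ryx rzy; apply: tr ryx. Qed.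

Lemma strict_order_subst M s r :
  strict_order s -> strict_order r -> autonomous M r ->
  strict_order (subst_rel M s r).
Proof.
move=> [sirr str] [rirr rtr] aut; split=> [x|y x z] /=; first by case: (_ && _); rewrite ?sirr ?rirr.
case: (boolP (x \in M)) => xM; case: (boolP (y \in M)) => yM;
  case: (boolP (z \in M)) => zM //=; try exact: str; try exact: rtr.
- by move=> _; rewrite (aut y x z yM xM zM).1.
- by rewrite (aut x z y xM zM yM).1 => rzy /(rtr _ _ _ rzy); rewrite rirr.
- by rewrite (aut y z x yM zM xM).2.
Qed.

Lemma same_comparability_subst M s r :
  same_comparability r s -> same_comparability (subst_rel M s r) r.
Proof. by move=> rs x y /=; rewrite andbC; case: ifP => // _; rewrite -rs orbC. Qed.

Lemma flip_strict M r : strict_order r -> autonomous M r -> strict_order (flip M r).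
Proof. by move=> ro; apply: strict_order_subst => //; apply: strict_order_rev. Qed.

Lemma same_comparability_flip M r : same_comparability (flip M r) r.
Proof. by apply: same_comparability_subst => x y; rewrite orbC. Qed.

Lemma autonomous_flip M X r : autonomous X r -> M \subset X \/ X \subset M ->
  autonomous X (flip M r).
Proof.
move=> aut MX x y z xX yX zX; rewrite /flip /=.
have [rxz rzx] := aut x y z xX yX zX.
case: MX => sub.
  by rewrite (contraNF (subsetP sub z) zX) !andbF /=.
by rewrite !(subsetP sub _ xX) !(subsetP sub _ yX) andbT /=; case: ifP.
Qed.

Lemma disagree_sym r s x y : disagree r s x y = disagree r s y x.
Proof. by rewrite /= orbC. Qed.

(** Both orders put [z] above [u]. One of them puts [u] above [v], hence [z] above [v], and on [v],
    [z] there is no disagreement. *)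
Lemma disagree_transfer r s u v z :
  strict_order r -> strict_order s -> same_comparability r s ->
  disagree r s u v -> ~~ disagree r s u z -> ~~ disagree r s v z -> r u z -> r v z.
Proof.
move=> [rirr rtr] [sirr str] rs duv nuz nvz ruz.
have suz : s u z.
  have := rs u z; rewrite ruz => /esym/orP[//|szu].
  by case/negP: nuz; rewrite /= ruz szu.
case/orP: duv => /andP[rv sv]; last exact: rtr ruz.
have svz := str _ _ _ sv suz.
have := rs v z; rewrite svz /= => /orP[//|rzv].
by case/negP: nvz; rewrite /= rzv svz orbT.
Qed.

Lemma autonomous_disagree r s x :
  strict_order r -> strict_order s -> same_comparability r s ->
  autonomous [set y | connect (disagree r s) x y] r.
Proof.
move=> ro so rs.
have dsym : connect_sym (disagree r s).
  by apply: sym_connect_sym => a b; rewrite disagree_sym.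
(* Stated for any two orders with this disagreement graph, so that the reversed orders give the
   other half of autonomy. *)
suff main r' s' : strict_order r' -> strict_order s' -> same_comparability r' s' ->
    disagree r' s' =2 disagree r s -> forall u v z, connect (disagree r s) u v ->
    ~~ connect (disagree r s) u z -> r' u z -> r' v z.
  move=> u v z; rewrite !inE => xu xv xz.
  have uv : connect (disagree r s) u v by apply: connect_trans xv; rewrite dsym.
  have uz : ~~ connect (disagree r s) u z by apply: contra xz; apply: connect_trans.
  have vz : ~~ connect (disagree r s) v z by apply: contra xz; apply: connect_trans.
  have vu : connect (disagree r s) v u by rewrite dsym.
  have rs_rev : same_comparability (fun x y => r y x) (fun x y => s y x).
    by move=> a b; rewrite rs.
  have d_rev : disagree (fun x y => r y x) (fun x y => s y x) =2 disagree r s.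
    by move=> a b; rewrite /= orbC.
  have main_rev := main _ _ (strict_order_rev ro) (strict_order_rev so) rs_rev d_rev.
  have main_fwd := main _ _ ro so rs (fun _ _ => erefl).
  split; apply/idP/idP.
  - exact: main_fwd uv uz.
  - exact: main_fwd vu vz.
  - exact: main_rev uv uz.
  - exact: main_rev vu vz.
move=> ro' so' rs' dE u v z /connectP[p + ->].
elim: p u => //= w p IHp u /andP[uw wp] uz ruz.
have wz : ~~ connect (disagree r s) w z.
  by apply: contra uz; apply: connect_trans; apply: connect1.
apply: (IHp w) => //; apply: (disagree_transfer ro' so' rs') ruz.
- by rewrite dE.
- by rewrite dE; apply: contra uz; apply: connect1.
- by rewrite dE; apply: contra wz; apply: connect1.
Qed.

(** * Induction along flips of autonomous sets *)

Section FlipInduction.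

Variable E : rel V -> rel V -> Prop.
Hypothesis E_refl : forall r s, r =2 s -> E r s.
Hypothesis E_trans : forall r s t, E r s -> E s t -> E r t.
Hypothesis E_flip : forall M r, strict_order r -> autonomous M r -> E r (flip M r).

(** Confining the differences between [r] and [s] to an autonomous [X] allows induction on the size
    of [X]. *)
Let linked X := forall r s, strict_order r -> strict_order s ->
  same_comparability r s -> autonomous X r ->
  (forall x y, ~~ ((x \in X) && (y \in X)) -> r x y = s x y) -> E r s.

(** No component of disagreement crosses [Y], so each is smaller than [X]. By induction on the
    number of reversed pairs, [r] is replaced by [s] on one component after another. *)
Lemma linked_split X r s Y y0 x0 :
  (forall X', #|X'| < #|X| -> linked X') ->
  strict_order r -> strict_order s -> same_comparability r s -> autonomous X r ->
  (forall x y, ~~ ((x \in X) && (y \in X)) -> r x y = s x y) ->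
  Y \subset X -> y0 \in Y -> x0 \in X -> x0 \notin Y ->
  (forall y z, y \in Y -> z \in X -> z \notin Y -> ~~ disagree r s y z) ->
  E r s.
Proof.
move=> IH + so; have [m] := ubnP #|[pred u | r u.1 u.2 && s u.2 u.1]|.
elim: m r => // m IHm r rm ro rs aut out YX y0Y x0X x0Y split.
case: (pickP [pred u | r u.1 u.2 && s u.2 u.1]) => [[x y] /= /andP[rxy syx]|same]; last first.
  apply: E_refl => x y; apply/idP/idP => h.
    have := rs x y; rewrite h => /esym/orP[//|sxy].
    by have := same (x, y); rewrite /= h sxy.
  have := rs x y; rewrite h => /orP[//|ryx].
  by have := same (y, x); rewrite /= h ryx.
have inX u v : disagree r s u v -> (u \in X) && (v \in X).
  apply: contraTT => nX; rewrite /= !out // ?[(v \in X) && _]andbC //.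
  by apply/negP => /orP[]/andP[/(asym so)->].
pose C := [set z | connect (disagree r s) x z].
have autC : autonomous C r by apply: autonomous_disagree.
have dsym : connect_sym (disagree r s).
  by apply: sym_connect_sym => a b; rewrite disagree_sym.
have /andP[xX yX] : (x \in X) && (y \in X) by apply: inX; rewrite /= rxy syx.
have xC : x \in C by rewrite inE.
have yC : y \in C by rewrite inE connect1 //= rxy syx.
have clX : closed (disagree r s) X.
  by move=> u v /inX /andP[-> ->].
have clY : closed (disagree r s) Y.
  apply: intro_closed => // u v duv uY; apply/negPn/negP => vY.
  have /andP[_ vX] := inX _ _ duv.
  by have := split u v uY vX vY; rewrite duv.
have CX : C \subset X.
  by apply/subsetP=> z; rewrite inE => /(closed_connect clX) <-.
have Csmall : #|C| < #|X|.
  apply: proper_card; apply/properP; split=> //.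
  have CY z : z \in C -> (z \in Y) = (x \in Y).
    by rewrite inE => /(closed_connect clY) ->.
  case: (boolP (x \in Y)) => xY.
    by exists x0 => //; apply/negP => /CY; rewrite xY (negPf x0Y).
  exists y0; first exact: (subsetP YX).
  by apply/negP => /CY; rewrite y0Y (negPf xY).
(* [t] differs from [r] only inside [C], and has fewer reversed pairs with [s]. *)
pose t := subst_rel C s r.
have to : strict_order t by apply: strict_order_subst.
have tr : same_comparability t r by apply: same_comparability_subst.
have dt u v : disagree t s u v -> disagree r s u v.
  rewrite /t /= [(v \in C) && _]andbC; case: ifP => // _.
  by case/orP=> /andP[/(asym so)->].
apply: (@E_trans _ t).
  apply: (IH C) => //.
  by move=> u v nC; rewrite /t /= (negPf nC).
apply: IHm => //.
- rewrite -ltnS; apply: leq_trans rm; rewrite ltnS; apply: proper_card; apply/properP; split.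
    apply/subsetP=> -[u v]; rewrite !inE /t /=.
    by case: ifP => // _ /andP[/(asym so)->].
  by exists (x, y); rewrite !inE /t /= ?rxy ?syx // xC yC (asym so syx).
- by move=> u v; rewrite tr.
- move=> u v z uX vX zX; rewrite /t /= (contraNF (subsetP CX z) zX) !andbF.
  exact: aut.
- by move=> u v nX; rewrite /t /= out //; case: ifP.
- by move=> u v uY vX vY; apply: contra (split u v uY vX vY); apply: dt.
Qed.

Lemma strict_order_maximal s X x0 : strict_order s -> x0 \in X ->
  exists2 x, x \in X & forall y, y \in X -> ~~ s x y.
Proof.
move=> [irr tr] x0X.
case: (arg_maxnP (fun x => #|[set z | s z x]|) x0X) => x xX xmax.
exists x => // y yX; apply/negP => sxy.
have := xmax y yX; rewrite /= leqNgt => /negP; apply.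
apply: proper_card; apply/properP; split.
  by apply/subsetP=> z; rewrite !inE => szx; apply: tr sxy.
by exists x; rewrite !inE ?irr.
Qed.

Definition colour r s x y : option bool :=
  if disagree r s x y then Some false else if r x y || r y x then Some true else None.

Lemma colour_sym r s x y : colour r s x y = colour r s y x.
Proof. by rewrite /colour disagree_sym orbC. Qed.

Lemma colour_rainbow r s x y z :
  strict_order r -> strict_order s -> same_comparability r s ->
  colour r s x y != colour r s y z ->
  (colour r s x z == colour r s x y) || (colour r s x z == colour r s y z).
Proof.
move=> ro so rs; pose c := colour r s.
(* By [disagree_transfer], an agreeing pair and a disagreeing pair with a common vertex are not
   completed by an incomparable pair. The six orderings of the vertices then exclude every rainbow
   triangle. *)
have tri u v w : [|| c u v != Some true, c v w != Some false | c u w != None].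
  rewrite /c /colour (disagree_sym r s u w) (disagree_sym r s u v).
  case dvu: (disagree r s v u) => //; case: ifP => // uv.
  case dvw: (disagree r s v w); last by case: ifP.
  case dwu: (disagree r s w u) => //.
  have d_rev : disagree (fun x y => r y x) (fun x y => s y x) =2 disagree r s.
    by move=> a b; rewrite /= orbC.
  case/orP: uv => [ruv|rvu].
    have -> // : r u w.
    apply: (disagree_transfer (strict_order_rev ro) (strict_order_rev so)) ruv.
    - by move=> a b; rewrite rs.
    - by rewrite d_rev.
    - by rewrite d_rev dvu.
    - by rewrite d_rev dwu.
  by rewrite (disagree_transfer ro so rs dvw _ _ rvu) ?orbT ?dvu ?dwu.
move: (tri x y z) (tri z y x) (tri x z y) (tri y z x) (tri y x z) (tri z x y); rewrite /c.
rewrite (colour_sym r s z x) (colour_sym r s z y) (colour_sym r s y x) -/c.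
by case: (c x y) => [[]|]; case: (c y z) => [[]|]; case: (c x z) => [[]|].
Qed.

Lemma flip_induction X : linked X.
Proof.
have [m] := ubnP #|X|; elim: m X => // m IHm X Xm r s ro so rs aut out.
have IH X' : #|X'| < #|X| -> linked X' by move=> X'X; apply: IHm; lia.
have [X1|X1] := leqP #|X| 1.
  apply: E_refl => x y; case: (boolP ((x \in X) && (y \in X))) => [/andP[xX yX]|]; last exact: out.
  by rewrite (card_le1_eqP X1 x y) // ro.1 so.1.
have neq : [&& Some false != Some true, Some false != None & Some true != None] by [].
have /and3P[n12 n13 n23] := neq.
have csym : forall x y, colour r s x y = colour r s y x by move=> x y; apply: colour_sym.
have crain x y z := @colour_rainbow r s x y z ro so rs.
case/or3P: (gallai_split csym crain n12 n13 n23 X1).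
(* Disagreement splits [X]: [linked_split] applies directly. *)
- case/existsP=> Y /and3P[/set0Pn[y0 y0Y] /properP[YX [x0 x0X x0Y]] /forall_inP cY].
  apply: (linked_split IH ro so rs aut out YX y0Y x0X x0Y) => y z yY zX zY.
  have /forall_inP/(_ z) := cY y yY; rewrite !inE zX zY /colour => /(_ isT).
  by case: ifP.
(* Agreement splits [X]: flipping [X] exchanges agreement and disagreement inside it, so that no
   disagreement crosses [Y]. *)
- case/existsP=> Y /and3P[/set0Pn[y0 y0Y] /properP[YX [x0 x0X x0Y]] /forall_inP cY].
  apply: (E_trans (E_flip ro aut)).
  have frs : same_comparability (flip X r) s.
    by move=> x y; rewrite same_comparability_flip rs.
  apply: (linked_split IH (flip_strict ro aut) so frs _ _ YX y0Y x0X x0Y).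
  + by apply: autonomous_flip => //; left.
  + by move=> x y xy; rewrite /= (negPf xy) out.
  move=> y z yY zX zY; rewrite /= (subsetP YX y yY) zX /=.
  have /forall_inP/(_ z) := cY y yY; rewrite !inE zX zY /colour => /(_ isT).
  apply: contra => /orP[]/andP[h1 h2] /=;
    by rewrite h1 (asym ro h1) (asym so h2) ?orbT.
(* Incomparability splits [X]. Let [K] be the incomparability component of an [s]-maximal [x]; the
   rest of [X] is comparable with all of [K], and [s] puts it below [K]. *)
have [x0 x0X] : exists x0, x0 \in X by apply/card_gt0P; lia.
have [x xX xmax] := strict_order_maximal so x0X.
move=> cN; have [w wX] := split_colour_connect csym xX cN.
set e := (X in connect X) => xw.
pose K := [set y | connect e x y].
have xK : x \in K by rewrite inE.
have KX : K \subset X.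
  apply/subsetP=> y; rewrite inE => /connectP[p + ->].
  by elim: p (x) xX => //= a p IHp b _ /andP[/and3P[_ aX _]]; apply: IHp.
have eK a b : a \in K -> b \in X -> b \notin K -> r a b || r b a.
  move=> aK bX; apply: contraNT => rab; rewrite inE.
  have aX := subsetP KX a aK; rewrite inE in aK.
  apply: connect_trans (aK) (connect1 _); rewrite /e /= aX bX /colour (negPf rab) /=.
  by move: rab; rewrite negb_or => /andP[/negPf-> /negPf->].
(* If [z] were below [a'] but above its incomparable neighbour [b], then [b] would be below [a']. *)
have const t z : strict_order t -> same_comparability t r ->
    z \in X -> z \notin K -> t z x -> forall a, a \in K -> t z a.
  move=> to tr zX zK tzx a; rewrite inE => /connectP[p + ->].
  elim: p (x) xK tzx => //= b p IHp a' a'K tza' /andP[eab].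
  have bK : b \in K by rewrite !inE in a'K *; apply: connect_trans (connect1 eab).
  apply: IHp => //; have := eK b z bK zX zK; rewrite -tr => /orP[tbz|//].
  case/and3P: eab => _ _; rewrite /colour; case: ifP => // _.
  by rewrite -tr (to.2 _ _ _ tbz tza') orbT.
have const_s z a : z \in X -> z \notin K -> a \in K -> s z a.
  move=> zX zK aK; apply: const => //.
  by have := eK x z xK zX zK; rewrite rs (negPf (xmax z zX)).
(* [M] is [K] together with the part of [X] that [r] puts above it. The rest of [X] lies below [M],
   so [M] is autonomous, and flipping [M] moves the upper part below [K], where [s] has it. *)
pose M := K :|: [set z in X | r x z].
have MX : M \subset X.
  by apply/subsetP=> z; rewrite !inE => /orP[|/andP[]//] xz; apply: (subsetP KX); rewrite inE.
have below z a : z \in X -> z \notin M -> a \in M -> r z a.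
  rewrite in_setU negb_or inE => zX /andP[zK]; rewrite zX /= => xz.
  have rzx : r z x by have := eK x z xK zX zK; rewrite (negPf xz).
  rewrite in_setU => /orP[aK|]; first exact: (const r z).
  by rewrite inE => /andP[_]; apply: ro.2.
have autM : autonomous M r.
  move=> u v z uM vM zM; case: (boolP (z \in X)) => zX.
    have zu := below z u zX zM uM; have zv := below z v zX zM vM.
    by rewrite zu zv (asym ro zu) (asym ro zv).
  by apply: aut => //; apply: (subsetP MX).
apply: (E_trans (E_flip ro autM)).
have frs : same_comparability (flip M r) s.
  by move=> a b; rewrite same_comparability_flip rs.
have wK : w \notin K by rewrite inE.
apply: (linked_split IH (flip_strict ro autM) so frs _ _ KX xK wX wK).
- by apply: autonomous_flip => //; left.
- move=> a b nX; rewrite /=; case: ifP => [/andP[aM bM]|_]; last exact: out.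
  by case/negP: nX; rewrite (subsetP MX _ aM) (subsetP MX _ bM).
move=> a z aK zX zK; have sza := const_s z a zX zK aK.
rewrite /disagree sza (asym so sza) andbT andbF orbF.
apply: negbT => /=.
have aM : a \in M by rewrite in_setU aK.
rewrite aM /=; case: (boolP (z \in M)) => zM; last by rewrite (asym ro) // below.
move: zM; rewrite in_setU (negPf zK) inE zX /= => rxz.
apply: (asym ro).
apply: (const (fun x y => r y x)) => //; first exact: strict_order_rev.
by move=> u v; rewrite orbC.
Qed.

End FlipInduction.
End Flips.

(** * K-Bender-Knuth involutions *)

Section BenderKnuth.

Context {V : finType}.
Implicit Types (r s : rel V) (m T U : {ffun V -> nat}) (i j n : nat).

Definition increasing r m := forall x y, r x y -> m x < m y.

(** The K-Bender-Knuth involution. The order [r] may stand in for its covers, since in an increasing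
    labeling related elements labelled [i] and [i.+1] form a cover. *)
Definition bk r i m : {ffun V -> nat} :=
  [ffun x => if m x == i then if [exists y, r x y && (m y == i.+1)] then i else i.+1
             else if m x == i.+1 then if [exists y, r y x && (m y == i)] then i.+1 else i
             else m x].

Lemma eq_bk r s i m : r =2 s -> bk r i m = bk s i m.
Proof.
move=> rs; apply/ffunP=> x; rewrite !ffunE.
by under eq_existsb => y do rewrite rs; under [in X in if X then i.+1 else i]eq_existsb => y do rewrite rs.
Qed.

(** Only a related pair labelled [i], [i.+1] is at risk, and there each element keeps the other from
    moving. *)
Lemma bk_increasing r i m : increasing r m -> increasing r (bk r i m).
Proof.
move=> inc x y rxy; have := inc x y rxy; rewrite !ffunE.
case: existsP => [_|nx]; case: existsP => [[x' /andP[rx'x /eqP mx']]|nx'];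
  case: existsP => [[y' /andP[ryy' /eqP my']]|ny]; case: existsP => [[y'' /andP[ry''y /eqP my'']]|ny''].
all: do 4?case: eqP; try lia.
all: move=> *; exfalso.
all: first [apply: nx | apply: ny'']; by [exists y; rewrite rxy; apply/eqP | exists x; rewrite rxy; apply/eqP].
Qed.

(** An element that is blocked and the element blocking it both stay, so the block persists. An
    element that has moved meets no obstacle in its new position and moves back. *)
Lemma bkK r i m : increasing r m -> bk r i (bk r i m) = m.
Proof.
move=> inc; apply/ffunP=> x.
have up y : m y = i ->
    [exists z, r y z && (bk r i m z == i.+1)] = [exists z, r y z && (m z == i.+1)].
  move=> my; apply: eq_existsb => z; case ryz: (r y z) => //=.
  have := inc _ _ ryz; rewrite my ffunE.
  case: (m z =P i) => [->|_ _]; first by rewrite ltnn.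
  case: (m z =P i.+1) => [_|/eqP/negPf-> //].
  by rewrite ifT ?eqxx //; apply/existsP; exists y; rewrite ryz my eqxx.
have down y : m y = i.+1 ->
    [exists z, r z y && (bk r i m z == i)] = [exists z, r z y && (m z == i)].
  move=> my; apply: eq_existsb => z; case rzy: (r z y) => //=.
  have := inc _ _ rzy; rewrite my ffunE ltnS.
  case: (m z =P i) => [_ _|ni le]; last by rewrite !ifF; apply/eqP; lia.
  by rewrite ifT ?eqxx //; apply/existsP; exists y; rewrite rzy my eqxx.
rewrite [LHS]ffunE.
have [mx|nxi] := eqVneq (m x) i.
  have -> : bk r i m x = if [exists y, r x y && (m y == i.+1)] then i else i.+1.
    by rewrite ffunE mx eqxx.
  case ex: [exists y, _]; first by rewrite eqxx up // ex mx.
  rewrite eqxx (gtn_eqF (ltnSn i)) ifF // ?mx //; apply/existsP=> -[z /andP[rzx]].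
  have := inc _ _ rzx; rewrite mx ffunE.
  by case: (m z =P i) => [|_]; [lia | case: (m z =P i.+1) => [|_]; [lia | case: eqP; lia]].
have [mx|nxi1] := eqVneq (m x) i.+1.
  have -> : bk r i m x = if [exists y, r y x && (m y == i)] then i.+1 else i.
    by rewrite ffunE (negPf nxi) mx eqxx.
  case ex: [exists y, _].
    by rewrite eqxx (gtn_eqF (ltnSn i)) down // ex mx.
  rewrite eqxx ifF // ?mx //; apply/existsP=> -[z /andP[rxz]].
  have := inc _ _ rxz; rewrite mx ffunE.
  by case: (m z =P i) => [|_]; [lia | case: (m z =P i.+1) => [|_]; [lia | case: eqP; lia]].
have -> : bk r i m x = m x by rewrite ffunE (negPf nxi) (negPf nxi1).
by rewrite (negPf nxi) (negPf nxi1).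
Qed.

Definition bks r (l : seq nat) m := foldl (fun m' i => bk r i m') m l.

Definition bks_rev r (l : seq nat) m := foldr (bk r) m l.

Lemma bks_increasing r l m : increasing r m -> increasing r (bks r l m).
Proof. by elim: l m => //= i l IHl m inc; apply/IHl/bk_increasing. Qed.

Lemma bks_rev_increasing r l m : increasing r m -> increasing r (bks_rev r l m).
Proof. by move=> inc; elim: l => //= i l IHl; apply: bk_increasing. Qed.

Lemma bksK r l m : increasing r m -> bks_rev r l (bks r l m) = m.
Proof.
by elim: l m => //= i l IHl m inc; rewrite IHl ?bkK //; apply: bk_increasing.
Qed.

Lemma bks_revK r l m : increasing r m -> bks r l (bks_rev r l m) = m.
Proof.
elim: l => //= i l IHl inc; rewrite /bks /= bkK; last exact: bks_rev_increasing.
exact: IHl.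
Qed.

Lemma eq_bks r s l m : r =2 s -> bks r l m = bks s l m.
Proof. by move=> rs; elim: l m => //= i l IHl m; rewrite (eq_bk _ _ rs). Qed.

(* Reverses the labels 0, ..., k - 1; the value k marks the elements outside
   the module. *)
Definition reverse_label (k v : nat) := if v < k then k.-1 - v else v.

Lemma reverse_labelK k : involutive (reverse_label k).
Proof. by move=> v; rewrite /reverse_label; case: ifP; case: ifP; lia. Qed.

Definition reverse_labels k m : {ffun V -> nat} := [ffun x => reverse_label k (m x)].

Lemma reverse_labels_inj k : injective (reverse_labels k).
Proof.
move=> m m' eqm; apply/ffunP=> x; apply: (can_inj (reverse_labelK k)).
by have := congr1 (fun f : {ffun V -> nat} => f x) eqm; rewrite !ffunE.
Qed.

(** Reversal sends the labels [i], [i.+1] to [k.-1 - i], [k.-2 - i], and obstacles above become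
    obstacles below. *)
Lemma bk_reverse r k i m : i.+1 < k ->
  bk (fun x y => r y x) i (reverse_labels k m) =
  reverse_labels k (bk r (k.-2 - i) m).
Proof.
move=> ik; apply/ffunP=> x.
have revi v : (reverse_label k v == i) = (v == (k.-2 - i).+1).
  by rewrite /reverse_label; case: ifP => vk; apply/eqP/eqP; lia.
have revi1 v : (reverse_label k v == i.+1) = (v == k.-2 - i).
  by rewrite /reverse_label; case: ifP => vk; apply/eqP/eqP; lia.
rewrite !ffunE revi revi1.
under eq_existsb => y do rewrite ffunE revi1.
under [in X in if X then i.+1 else i]eq_existsb => y do rewrite ffunE revi.
case: eqP => [->|_].
  rewrite (gtn_eqF (ltnSn _)).
  by case: [exists y, _]; rewrite /reverse_label; case: ifP; lia.
by case: eqP => // _; case: [exists y, _]; rewrite /reverse_label; case: ifP; lia.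
Qed.

(** The ascending indices become descending ones; for [n = k.-1] the result is the inverse of the
    whole product. *)
Lemma bks_reverse r k n m : n <= k.-1 ->
  bks (fun x y => r y x) (iota 0 n) (reverse_labels k m) =
  reverse_labels k (bks_rev r (iota (k.-1 - n) n) m).
Proof.
elim: n => // n IHn nk; rewrite -addn1 iotaD /bks foldl_cat /= -/(bks _ _ _).
rewrite IHn ?bk_reverse; try lia.
have -> : k.-1 - n = (k.-1 - (n + 1)).+1 by lia.
by rewrite addn1 /=; congr (reverse_labels k (bk r _ _)); lia.
Qed.

End BenderKnuth.

(** * Tableaux on an autonomous set *)

Section SortedIndex.

Variable S : seq nat.
Hypothesis sortedS : sorted ltn S.

Lemma sorted_ltn_uniq : uniq S.
Proof. exact: (sorted_uniq ltn_trans ltnn). Qed.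

Lemma index_ltn_sorted u v : u \in S -> v \in S -> (index u S < index v S) = (u < v).
Proof.
move=> uS vS; apply/idP/idP; first exact: (sorted_ltn_index ltn_trans).
apply: contraTT; rewrite -!leqNgt leq_eqVlt => /orP[/eqP/(index_inj 0)->//|].
by move/(sorted_ltn_index ltn_trans sortedS _ _ vS uS)/ltnW.
Qed.

Lemma index_succ u : u \in S -> u.+1 \in S -> index u.+1 S = (index u S).+1.
Proof.
move=> uS u1S; apply/eqP; rewrite eqn_leq index_ltn_sorted // ltnSn andbT leqNgt.
apply/negP => lt; have szw : (index u S).+1 < size S.
  by apply: leq_trans lt _; rewrite index_size.
have wS := mem_nth 0 szw; have iw := index_uniq 0 szw sorted_ltn_uniq.
have := index_ltn_sorted wS u1S; have := index_ltn_sorted uS wS; rewrite iw; lia.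
Qed.

Lemma index_maximum u : u \in S -> {in S, forall v, v <= u} -> index u S = (size S).-1.
Proof.
move=> uS umax; have := uS; rewrite -index_mem leq_eqVlt => /orP[/eqP<-//|szw].
have wS := mem_nth 0 szw; have iw := index_uniq 0 szw sorted_ltn_uniq.
have := index_ltn_sorted uS wS; have := umax _ wS; rewrite iw; lia.
Qed.

Lemma index_minimum u : u \in S -> {in S, forall v, u <= v} -> index u S = 0.
Proof.
move=> uS umin; have sz0 : 0 < size S by rewrite -has_predT; apply/hasP; exists u.
have wS := mem_nth 0 sz0; have iw := index_uniq 0 sz0 sorted_ltn_uniq.
by have := index_ltn_sorted wS uS; have := umin _ wS; rewrite iw; lia.
Qed.

End SortedIndex.

Section Module.

Context {V : finType} (M : {set V}).
Implicit Types (r s : rel V) (T U : {ffun V -> nat}) (x y : V) (i n v : nat).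

Definition labels T : seq nat := sort leq (undup [seq T x | x in M]).

Lemma labelsP T v : reflect (exists2 x, x \in M & T x = v) (v \in labels T).
Proof.
by rewrite mem_sort mem_undup; apply: (iffP imageP) => -[x]; exists x.
Qed.

Lemma mem_labels T x : x \in M -> T x \in labels T.
Proof. by move=> xM; apply/labelsP; exists x. Qed.

Lemma labels_sorted T : sorted ltn (labels T).
Proof. by rewrite ltn_sorted_uniq_leq sort_uniq undup_uniq sort_sorted //; apply: leq_total. Qed.

Lemma eq_labels T (S : seq nat) : sorted ltn S ->
  (forall v, v \in S <-> exists2 x, x \in M & T x = v) -> labels T = S.
Proof.
move=> sS eS; apply: (irr_sorted_eq ltn_trans ltnn) => //; first exact: labels_sorted.
by move=> v; apply/labelsP/idP => /eS.
Qed.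

(** The value outside [M] exceeds all ranks, so that the involutions between ranks ignore it and
    [reverse_label] fixes it. *)
Definition pack T : {ffun V -> nat} :=
  [ffun x => if x \in M then index (T x) (labels T) else size (labels T)].

Definition inside r : rel V := fun x y => [&& x \in M, y \in M & r x y].

Lemma pack_increasing r T : increasing r T -> increasing (inside r) (pack T).
Proof.
move=> inc x y /and3P[xM yM rxy]; rewrite !ffunE xM yM.
by rewrite index_ltn_sorted ?mem_labels ?labels_sorted // inc.
Qed.

Definition same_skeleton T U :=
  {in [predC M], T =1 U} /\ labels T = labels U.

Lemma skeleton_pack_inj T U : same_skeleton T U -> pack T = pack U -> T = U.
Proof.
move=> [out lab] eqp; apply/ffunP=> x; case: (boolP (x \in M)) => xM; last exact: out.
have := congr1 (fun f : {ffun V -> nat} => f x) eqp; rewrite !ffunE xM lab.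
by apply: (index_inj 0); rewrite -?lab ?mem_labels // lab mem_labels.
Qed.

Definition swap i v := if v == i then i.+1 else if v == i.+1 then i else v.

Lemma swap_inj i : injective (swap i).
Proof. by apply: (can_inj (g := swap i)) => v; rewrite /swap; do !case: eqP; lia. Qed.

(** [swap i] breaks the order of a set of labels only if [i] and [i.+1] both belong to it. *)
Lemma labels_swap i T U : ~~ ((i \in labels T) && (i.+1 \in labels T)) ->
  {in M, forall x, U x = swap i (T x)} -> labels U = map (swap i) (labels T).
Proof.
move=> nb UT; apply: eq_labels.
  apply: (@homo_sorted_in _ _ [in labels T] _ ltn) (labels_sorted T); last exact/allP.
  move=> u v uS vS; rewrite /swap /= => uv.
  have : ~ (u = i /\ v = i.+1) by move=> [ui vi]; case/negP: nb; rewrite -vi -ui; apply/andP; split.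
  by do !case: eqP; lia.
move=> v; split=> [/mapP[u /labelsP[x xM <-] ->]|[x xM <-]]; first by exists x; rewrite ?UT.
by rewrite UT // map_f ?mem_labels.
Qed.

(** Meant for the case where at most one of [i], [i.+1] occurs on [M]: by autonomy an obstacle
    outside [M] then blocks all elements of [M] with that label, or none. *)
Definition movable r i T : bool :=
  ~~ if i \in labels T
     then [exists y, [&& y \notin M, [exists x in M, r x y] & T y == i.+1]]
     else [exists y, [&& y \notin M, [exists x in M, r y x] & T y == i]].

Lemma bk_module r i T : increasing r T -> autonomous M r ->
  ~~ ((i \in labels T) && (i.+1 \in labels T)) ->
  {in M, forall x, bk r i T x = if movable r i T then swap i (T x) else T x}.
Proof.
move=> inc aut nb x xM; rewrite ffunE /swap /movable.
have [Tx|nTi] := eqVneq (T x) i.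
  have iS : i \in labels T by rewrite -Tx mem_labels.
  have i1S : i.+1 \notin labels T by rewrite iS in nb.
  suff -> : [exists y, r x y && (T y == i.+1)] =
      [exists y, [&& y \notin M, [exists x0 in M, r x0 y] & T y == i.+1]].
    by rewrite iS Tx; case: [exists y, _].
  apply/existsP/existsP => -[y].
    case/andP=> rxy Ty; exists y; rewrite Ty andbT; apply/andP; split.
      by apply: contra i1S => yM; rewrite -(eqP Ty) mem_labels.
    by apply/existsP; exists x; rewrite xM.
  case/and3P=> yM /existsP[z /andP[zM rzy]] Ty; exists y.
  by rewrite (aut x z y xM zM yM).1 rzy.
have [Tx|nTi1] := eqVneq (T x) i.+1; last by rewrite if_same.
have i1S : i.+1 \in labels T by rewrite -Tx mem_labels.
have iS : i \notin labels T by rewrite i1S andbT in nb.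
suff -> : [exists y, r y x && (T y == i)] =
    [exists y, [&& y \notin M, [exists x0 in M, r y x0] & T y == i]].
  by rewrite (negPf iS) Tx; case: [exists y, _].
apply/existsP/existsP => -[y].
  case/andP=> ryx Ty; exists y; rewrite Ty andbT; apply/andP; split.
    by apply: contra iS => yM; rewrite -(eqP Ty) mem_labels.
  by apply/existsP; exists x; rewrite xM.
case/and3P=> yM /existsP[z /andP[zM ryz]] Ty; exists y.
by rewrite (aut x z y xM zM yM).2 ryz.
Qed.

Lemma labels_bk_other r i T : increasing r T -> autonomous M r ->
  ~~ ((i \in labels T) && (i.+1 \in labels T)) ->
  labels (bk r i T) = if movable r i T then map (swap i) (labels T) else labels T.
Proof.
move=> inc aut nb; have bkT := bk_module inc aut nb; move: bkT; case: ifP => _ bkT.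
  exact: labels_swap.
apply: eq_labels (labels_sorted T) _ => v.
by split=> [/labelsP[x xM <-]|[x xM <-]]; [exists x; rewrite ?bkT | rewrite bkT ?mem_labels].
Qed.

Lemma pack_bk_other r i T : increasing r T -> autonomous M r ->
  ~~ ((i \in labels T) && (i.+1 \in labels T)) -> pack (bk r i T) = pack T.
Proof.
move=> inc aut nb; apply/ffunP=> x; rewrite [LHS]ffunE [RHS]ffunE labels_bk_other //.
case: (boolP (x \in M)) => xM; last by case: ifP => _; rewrite ?size_map.
rewrite bk_module //.
by case: ifP => // _; rewrite index_map //; apply: swap_inj.
Qed.

(** An obstacle outside [M] is impossible: autonomy would relate it to an element of [M] with the
    same label. *)
Lemma bk_inside r i T : increasing r T -> autonomous M r ->
  i \in labels T -> i.+1 \in labels T ->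
  {in M, bk r i T =1 bk (inside r) i T}.
Proof.
move=> inc aut iS i1S x xM; rewrite !ffunE.
have [z zM Tz] := labelsP _ _ iS; have [w wM Tw] := labelsP _ _ i1S.
case: eqP => [Tx|_].
  congr (if _ then _ else _); apply: eq_existsb => y; rewrite /inside xM /=.
  case: (boolP (y \in M)) => yM //=; apply/negP => /andP[rxy /eqP Ty].
  by have := inc w y; rewrite -(aut x w y xM wM yM).1 rxy Tw Ty ltnn => /(_ isT).
case: eqP => // Tx; congr (if _ then _ else _); apply: eq_existsb => y.
rewrite /inside xM /=; case: (boolP (y \in M)) => yM //=; apply/negP => /andP[ryx /eqP Ty].
by have := inc y z; rewrite -(aut x z y xM zM yM).2 ryx Tz Ty ltnn => /(_ isT).
Qed.

(** The label [i] survives: either some element labelled [i] is blocked and stays, or no element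
    labelled [i.+1] is blocked and all of these move down. The label [i.+1] is symmetric. *)
Lemma labels_bk_both r i T : increasing r T -> autonomous M r ->
  i \in labels T -> i.+1 \in labels T -> labels (bk r i T) = labels T.
Proof.
move=> inc aut iS i1S; apply: eq_labels (labels_sorted T) _ => v.
have bkT := bk_inside inc aut iS i1S.
split=> [vS|[x xM <-]]; last first.
  rewrite bkT // ffunE; do 2![case: ifP => // _; first by case: ifP].
  exact: mem_labels.
have [vi|nvi] := eqVneq v i.
  case: (boolP [exists x in M, (T x == i) && [exists y, inside r x y && (T y == i.+1)]]).
    by case/exists_inP=> x xM /andP[Tx ex]; exists x; rewrite // bkT // ffunE Tx ex.
  move=> none; have [w wM Tw] := labelsP _ _ i1S; exists w => //.
  rewrite bkT // ffunE Tw (gtn_eqF (ltnSn _)) eqxx ifF //.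
  apply/existsP=> -[y /andP[ryw Ty]]; case/negP: none; apply/exists_inP.
  have /and3P[yM _ _] := ryw; exists y; rewrite // Ty.
  by apply/existsP; exists w; rewrite ryw Tw /=.
have [vi1|nvi1] := eqVneq v i.+1.
  case: (boolP [exists x in M, (T x == i.+1) && [exists y, inside r y x && (T y == i)]]).
    case/exists_inP=> x xM /andP[Tx ex]; exists x; rewrite // bkT // ffunE (eqP Tx).
    by rewrite (gtn_eqF (ltnSn _)) eqxx ex.
  move=> none; have [w wM Tw] := labelsP _ _ iS; exists w => //.
  rewrite bkT // ffunE Tw eqxx ifF //.
  apply/existsP=> -[y /andP[rwy Ty]]; case/negP: none; apply/exists_inP.
  have /and3P[_ yM _] := rwy; exists y; rewrite // Ty.
  by apply/existsP; exists w; rewrite rwy Tw /=.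
have [x xM Tx] := labelsP _ _ vS; exists x => //.
by rewrite bkT // ffunE Tx (negPf nvi) (negPf nvi1).
Qed.

Lemma pack_bk_both r i T : increasing r T -> autonomous M r ->
  i \in labels T -> i.+1 \in labels T ->
  pack (bk r i T) = bk (inside r) (index i (labels T)) (pack T).
Proof.
move=> inc aut iS i1S; have lab := labels_bk_both inc aut iS i1S.
have i1E := index_succ (labels_sorted T) iS i1S.
have eqi x u : x \in M -> u \in labels T -> (pack T x == index u (labels T)) = (T x == u).
  move=> xM uS; rewrite ffunE xM; apply/eqP/eqP => [|-> //].
  by apply: (index_inj 0) => //; apply: mem_labels.
apply/ffunP=> x; rewrite [LHS]ffunE lab [RHS]ffunE -i1E.
case: (boolP (x \in M)) => xM; last first.
  by rewrite !ffunE (negPf xM) !gtn_eqF // index_mem.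
rewrite bk_inside // ffunE !eqi //.
have ex1 : [exists y, inside r x y && (pack T y == index i.+1 (labels T))]
         = [exists y, inside r x y && (T y == i.+1)].
  apply: eq_existsb => y; case: (boolP (y \in M)) => yM; first by rewrite eqi.
  by rewrite /inside (negPf yM) andbF.
have ex2 : [exists y, inside r y x && (pack T y == index i (labels T))]
         = [exists y, inside r y x && (T y == i)].
  apply: eq_existsb => y; case: (boolP (y \in M)) => yM; first by rewrite eqi.
  by rewrite /inside (negPf yM).
rewrite ex1 ex2; do 2![case: ifP => _; first by case: ifP].
by rewrite ffunE xM.
Qed.

End Module.

(** * K-promotion after reversing an autonomous set *)

Section Promotion.

Context {V : finType}.
Implicit Types (r s : rel V) (M : {set V}) (T U : {ffun V -> nat}) (q n i k : nat).

Definition tableau q r T := (forall x, 0 < T x <= q) /\ increasing r T.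

Definition promotion q r T := bks r (iota 1 q.-1) T.

Lemma bk_bounded q i r T : 0 < i < q ->
  (forall x, 0 < T x <= q) -> forall x, 0 < bk r i T x <= q.
Proof.
move=> iq T0 x; have := T0 x; rewrite ffunE.
by do 2![case: ifP => _; first by case: ifP => _; lia].
Qed.

Lemma bks_tableau q r (l : seq nat) T : {in l, forall i, 0 < i < q} ->
  tableau q r T -> tableau q r (bks r l T).
Proof.
elim: l T => //= i l IHl T lq [T0 inc]; apply: IHl.
  by move=> j jl; apply: lq; rewrite inE jl orbT.
by split; [apply: bk_bounded => //; apply: lq; rewrite inE eqxx | apply: bk_increasing].
Qed.

Lemma promotion_tableau q r T : tableau q r T -> tableau q r (promotion q r T).
Proof. by apply: bks_tableau => i; rewrite mem_iota; lia. Qed.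

Lemma eq_promotion q r s T : r =2 s -> promotion q r T = promotion q s T.
Proof. exact: eq_bks. Qed.

End Promotion.

Section FlipDynamics.

Context {V : finType} (M : {set V}) (r : rel V).
Implicit Types (T U : {ffun V -> nat}) (q n i k v : nat).
Hypothesis aut : autonomous M r.

Let r' : rel V := flip M r.

Lemma flip_autonomous : autonomous M r'.
Proof. by apply: autonomous_flip => //; left. Qed.

Lemma flipEl x y : x \notin M -> r' x y = r x y.
Proof. by move=> xM; rewrite /r' /flip /subst_rel /= (negPf xM). Qed.

Lemma flipEr x y : y \notin M -> r' x y = r x y.
Proof. by move=> yM; rewrite /r' /flip /subst_rel /= (negPf yM) andbF. Qed.

Lemma inside_flip : inside M r' =2 (fun x y => inside M r y x).
Proof.
move=> x y; rewrite /inside /r' /flip /subst_rel.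
by case: (x \in M); case: (y \in M).
Qed.

Lemma skeleton_sym T U : same_skeleton M T U -> same_skeleton M U T.
Proof. by case=> out lab; split=> // x xM; rewrite out. Qed.

(** A relation that is constant on [M] sees which labels occur on [M], but not where. *)
Lemma exists_skeleton (s : rel V) x v T U :
  (forall y z, y \in M -> z \in M -> s x y = s x z) -> same_skeleton M T U ->
  [exists y, s x y && (T y == v)] = [exists y, s x y && (U y == v)].
Proof.
move=> sM; suff imp T' U' : same_skeleton M T' U' ->
    [exists y, s x y && (T' y == v)] -> [exists y, s x y && (U' y == v)].
  by move=> TU; apply/idP/idP; apply: imp => //; apply: skeleton_sym.
move=> [out lab] /existsP[y /andP[sxy /eqP Ty]]; apply/existsP.
case: (boolP (y \in M)) => yM; last by exists y; rewrite sxy -out ?Ty /=.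
have /labelsP[z zM Uz] : v \in labels M U' by rewrite -lab -Ty mem_labels.
by exists z; rewrite -(sM y) // sxy Uz /=.
Qed.

Lemma movable_flip i T U : same_skeleton M T U -> movable M r' i U = movable M r i T.
Proof.
move=> [out lab]; rewrite /movable -lab; congr (~~ (if _ then _ else _)).
  apply: eq_existsb => y; case: (boolP (y \in M)) => //= yM.
  by rewrite out //; under eq_existsb => x do rewrite flipEr //.
apply: eq_existsb => y; case: (boolP (y \in M)) => //= yM.
by rewrite out //; under eq_existsb => x do rewrite flipEl //.
Qed.

Lemma skeleton_bk i T U : increasing r T -> increasing r' U ->
  same_skeleton M T U -> same_skeleton M (bk r i T) (bk r' i U).
Proof.
move=> incT incU TU; have [out lab] := TU; split.
  move=> x xM; have xM' : x \notin M by []; rewrite !ffunE (out x xM).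
  have -> : [exists y, r' x y && (U y == i.+1)] = [exists y, r x y && (T y == i.+1)].
    under eq_existsb => y do rewrite flipEl //.
    apply/esym/exists_skeleton => // y z yM zM.
    by rewrite (aut yM zM xM').2.
  suff -> : [exists y, r' y x && (U y == i)] = [exists y, r y x && (T y == i)] by [].
  under eq_existsb => y do rewrite flipEr //.
  apply/esym/(@exists_skeleton (fun a b => r b a)) => // y z yM zM.
  by rewrite (aut yM zM xM').1.
case: (boolP ((i \in labels M T) && (i.+1 \in labels M T))) => [/andP[iS i1S]|nb].
  by rewrite !labels_bk_both // -?lab //; apply: flip_autonomous.
rewrite !labels_bk_other // -?lab ?(movable_flip i TU) //; exact: flip_autonomous.
Qed.

Let steps n T := bks (inside M r) (iota 0 n) T.
Let steps' n T := bks (fun x y => inside M r y x) (iota 0 n) T.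

(* Before the i-th involution, the pack has undergone n involutions; n is the
   number of labels of M below i if i is itself a label of M, and otherwise
   M has not been entered at all (n = 0) or has been traversed completely. *)
Let phase i n T := if i \in labels M T then n = index i (labels M T)
  else n = 0 \/ n = (size (labels M T)).-1 /\ {in labels M T, forall v, v < i}.

(** Invariant of the two parallel runs from [T0] and [U0]: one [n] counts the involutions that both
    packs have undergone. *)
Let synchronized i T0 U0 T U := [/\ increasing r T, increasing r' U,
  same_skeleton M T U, size (labels M T) = size (labels M T0) &
  exists n, [/\ phase i n T, pack M T = steps n (pack M T0)
              & pack M U = steps' n (pack M U0)]].

Lemma synchronized_bk i T0 U0 T U :
  synchronized i T0 U0 T U -> synchronized i.+1 T0 U0 (bk r i T) (bk r' i U).
Proof.
case=> incT incU TU szT [n [ph pT pU]].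
have TU' := skeleton_bk i incT incU TU.
have [out lab] := TU; have aut' := flip_autonomous.
have sS := labels_sorted M T.
(* If both labels occur on [M], each pack makes one step, at the index of [i]. *)
case: (boolP ((i \in labels M T) && (i.+1 \in labels M T))) => [/andP[iS i1S]|nb].
  have labT := labels_bk_both incT aut iS i1S.
  split=> //; [exact: bk_increasing|exact: bk_increasing|by rewrite labT|].
  move: ph; rewrite /phase iS => nE; exists n.+1; rewrite /phase labT i1S.
  rewrite index_succ // -nE; split=> //.
    by rewrite pack_bk_both // -nE pT /steps -[in RHS]addn1 iotaD /bks foldl_cat.
  rewrite pack_bk_both // -?lab // -nE pU /steps' -[in RHS]addn1 iotaD /bks foldl_cat /=.
  exact/eq_bk/inside_flip.
have nb' : ~~ ((i \in labels M U) && (i.+1 \in labels M U)) by rewrite -lab.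
have labT := labels_bk_other incT aut nb.
split=> //; [exact: bk_increasing|exact: bk_increasing| |].
  by rewrite labT; case: ifP; rewrite ?size_map.
exists n; rewrite !pack_bk_other //; split=> //.
move: ph labT; rewrite /phase => ph ->.
case: (boolP (i \in labels M T)) nb ph => iS /=.
  (* Only [i] occurs. If it moves up, its index is unchanged. If it is blocked, an obstacle labelled
     [i.+1] lies above all of [M], so [i] is the largest label and the traversal is complete. *)
  move=> i1S nE; case mv: (movable M r i T); last first.
    rewrite (negPf i1S); move: mv; rewrite /movable iS => /negbFE/existsP[y /and3P[yM /exists_inP[x xM rxy] /eqP Ty]].
    have small : {in labels M T, forall v, v < i.+1}.
      by move=> v /labelsP[z zM <-]; rewrite -Ty; apply: incT; rewrite -(aut xM zM yM).1.
    by right; split=> //; rewrite nE index_maximum.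
  have -> : i.+1 = swap i i by rewrite /swap eqxx.
  by rewrite map_f // index_map //; apply: swap_inj.
move=> _ ph; case: (boolP (i.+1 \in labels M T)) => i1S; last first.
  have -> : map (swap i) (labels M T) = labels M T.
    rewrite -[RHS]map_id; apply/eq_in_map => v vS; rewrite /swap.
    by do 2![case: eqP => [E|_]; first by rewrite -E vS in iS i1S].
  rewrite if_same (negPf i1S); case: ph => [->|[nE small]]; [by left|right].
  by split=> // v /small; lia.
(* Only [i.+1] occurs, so [M] has not been entered. If it moves down, this remains so. If it is
   blocked, an obstacle labelled [i] lies below all of [M], and [i.+1] is the least label, of index
   0. *)
have n0 : n = 0 by case: ph => [//|[_ /(_ _ i1S)]]; lia.
case mv: (movable M r i T).
  have -> : i.+1 = swap i i by rewrite /swap eqxx.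
  by rewrite mem_map ?(negPf iS); [left | apply: swap_inj].
rewrite i1S; move: mv; rewrite /movable (negPf iS) => /negbFE/existsP[y /and3P[yM /exists_inP[x xM ryx] /eqP Ty]].
rewrite index_minimum // => v /labelsP[z zM <-]; rewrite -Ty; apply: incT.
by rewrite -(aut xM zM yM).2.
Qed.

Lemma synchronized_bks i k T0 U0 T U : synchronized i T0 U0 T U ->
  synchronized (i + k) T0 U0 (bks r (iota i k) T) (bks r' (iota i k) U).
Proof.
elim: k i T U => [|k IHk] i T U; first by rewrite addn0.
by move/synchronized_bk/IHk; rewrite addSnnS.
Qed.

(** At the end [q], if it occurs on [M], is the largest label there, so the phase is 0 or complete.
    The boolean [b] records which, for both orders at once. *)
Lemma promotion_module q T U : 0 < q -> tableau q r T -> tableau q r' U ->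
  same_skeleton M T U ->
  [/\ same_skeleton M (promotion q r T) (promotion q r' U),
      size (labels M (promotion q r T)) = size (labels M T) &
      exists b : bool, let n := (size (labels M T)).-1 * b in
        pack M (promotion q r T) = steps n (pack M T) /\
        pack M (promotion q r' U) = steps' n (pack M U)].
Proof.
move=> q0 [T0 incT] [U0 incU] TU.
have init : synchronized 1 T U T U.
  split=> //; exists 0; split=> //; rewrite /phase; case: ifP => [oneS|_]; last by left.
  by rewrite index_minimum ?labels_sorted // => v /labelsP[x _ <-]; have /andP[] := T0 x.
have := synchronized_bks q.-1 init; rewrite add1n prednK //.
case=> _ _ TU' szT [n [ph pT pU]]; split=> //.
have [P0 _] := promotion_tableau (conj T0 incT).
suff [n0|nk] : n = 0 \/ n = (size (labels M T)).-1.
- by exists false; rewrite muln0 -n0.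
- by exists true; rewrite muln1 -nk.
move: ph; rewrite /phase -/(promotion q r T) szT; case: ifP => [qS ->|_]; last by case=> [|[]]; auto.
right; rewrite index_maximum ?labels_sorted // ?szT // => v /labelsP[x _ <-].
by have /andP[] := P0 x.
Qed.

(** [e] counts the promotions with [b = true], the only ones that act on the packs. *)
Lemma iter_promotion_module q T U t : 0 < q -> tableau q r T -> tableau q r' U ->
  same_skeleton M T U -> let k := size (labels M T) in
  same_skeleton M (iter t (promotion q r) T) (iter t (promotion q r') U) /\
  exists e, pack M (iter t (promotion q r) T) = iter e (steps k.-1) (pack M T) /\
            pack M (iter t (promotion q r') U) = iter e (steps' k.-1) (pack M U).
Proof.
move=> q0 tT tU TU k.
have tab (s : rel V) W u : tableau q s W -> tableau q s (iter u (promotion q s) W).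
  by move=> tW; elim: u => //= u IHu; apply: promotion_tableau.
suff [//] : [/\ same_skeleton M (iter t (promotion q r) T) (iter t (promotion q r') U),
    size (labels M (iter t (promotion q r) T)) = k &
    exists e, pack M (iter t (promotion q r) T) = iter e (steps k.-1) (pack M T) /\
            pack M (iter t (promotion q r') U) = iter e (steps' k.-1) (pack M U)].
elim: t => [|t [TUt szt [e [pT pU]]]]; first by split=> //; exists 0.
have [TUt1 szt1 [b]] := promotion_module q0 (tab _ _ t tT) (tab _ _ t tU) TUt.
rewrite szt /= => -[pT1 pU1]; split=> //; first by rewrite szt1.
case: b pT1 pU1; rewrite ?muln0 ?muln1 => pT1 pU1.
  by exists e.+1; rewrite pT1 pU1 pT pU.
by exists e; rewrite pT1 pU1.
Qed.

(* Reversal turns the steps in M into those of the flipped order, run backwards,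
   and a finite composite of involutions fixes the same points as its inverse. *)
Lemma iter_promotion_flip q T U t : 0 < q -> tableau q r T -> tableau q r' U ->
  same_skeleton M T U -> pack M U = reverse_labels (size (labels M T)) (pack M T) ->
  iter t (promotion q r') U = U <-> iter t (promotion q r) T = T.
Proof.
move=> q0 tT tU TU pU; set k := size (labels M T) in pU.
have [TUt [e [pTt pUt]]] := iter_promotion_module t q0 tT tU TU.
rewrite -/k in pTt pUt; have [out lab] := TU; have [outt labt] := TUt.
pose m := pack M T; pose back := bks_rev (inside M r) (iota 0 k.-1).
have incm : increasing (inside M r) m by apply: pack_increasing; case: tT.
have inc_steps u : increasing (inside M r) (iter u (steps k.-1) m).
  by elim: u => //= u IHu; apply: bks_increasing.
have inc_back u : increasing (inside M r) (iter u back m).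
  by elim: u => //= u IHu; apply: bks_rev_increasing.
(* A full run has [k.-1] steps, the case of [bks_reverse] in which the inverse run starts again at
   index 0. *)
have rev_iter u : iter u (steps' k.-1) (reverse_labels k m) = reverse_labels k (iter u back m).
  by elim: u => //= u ->; rewrite /steps' bks_reverse // subnn.
have backK u : iter u back (iter u (steps k.-1) m) = m.
  by elim: u => //= u IHu; rewrite -iterS iterSr /back bksK.
have stepsK u : iter u (steps k.-1) (iter u back m) = m.
  by elim: u => //= u IHu; rewrite -iterS iterSr /steps bks_revK.
have fixE : (pack M (iter t (promotion q r') U) = pack M U) <->
            (pack M (iter t (promotion q r) T) = pack M T).
  rewrite pUt pU rev_iter pTt -/m; split=> [/reverse_labels_inj fm|fm].
    by rewrite -{1}fm stepsK.
  by rewrite -{1}fm backK.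
split=> fixed; apply: (@skeleton_pack_inj _ M).
- split; last by rewrite labt fixed.
  by move=> x xM; rewrite (outt x xM) fixed out.
- by apply/fixE; rewrite fixed.
- split; last by rewrite -labt fixed.
  by move=> x xM; rewrite -(outt x xM) fixed out.
- by apply/fixE; rewrite fixed.
Qed.

Definition reverse_module T : {ffun V -> nat} :=
  [ffun x => if x \in M
             then nth 0 (labels M T)
                    (reverse_label (size (labels M T)) (index (T x) (labels M T)))
             else T x].

Lemma reverse_label_lt k v : (reverse_label k v < k) = (v < k).
Proof. by rewrite /reverse_label; case: ifP; lia. Qed.

Lemma mem_reverse_module T x : x \in M -> reverse_module T x \in labels M T.
Proof.
by move=> xM; rewrite ffunE xM mem_nth // reverse_label_lt index_mem mem_labels.
Qed.

Lemma labels_reverse_module T : labels M (reverse_module T) = labels M T.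
Proof.
apply: eq_labels (labels_sorted M T) _ => v.
split=> [vS|[x xM <-]]; last exact: mem_reverse_module.
pose S := labels M T; pose j := reverse_label (size S) (index v S).
have jS : j < size S by rewrite reverse_label_lt index_mem.
have /labelsP[x xM Tx] := mem_nth 0 jS.
exists x; rewrite // ffunE xM Tx index_uniq ?(sorted_ltn_uniq (labels_sorted M T)) //.
by rewrite reverse_labelK nth_index.
Qed.

Lemma skeleton_reverse_module T : same_skeleton M T (reverse_module T).
Proof.
split; last by rewrite labels_reverse_module.
by move=> x xM; have xM' : x \notin M by []; rewrite ffunE (negPf xM').
Qed.

Lemma index_reverse_module T x : x \in M ->
  index (reverse_module T x) (labels M T) =
  reverse_label (size (labels M T)) (index (T x) (labels M T)).
Proof.
move=> xM; rewrite ffunE xM index_uniq ?(sorted_ltn_uniq (labels_sorted M T)) //.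
by rewrite reverse_label_lt index_mem mem_labels.
Qed.

Lemma pack_reverse_module T :
  pack M (reverse_module T) = reverse_labels (size (labels M T)) (pack M T).
Proof.
apply/ffunP=> x; rewrite [LHS]ffunE labels_reverse_module [RHS]ffunE [pack M T x]ffunE.
case: (boolP (x \in M)) => xM; first exact: index_reverse_module.
by rewrite /reverse_label ltnn.
Qed.

Lemma reverse_moduleK : involutive reverse_module.
Proof.
move=> T; apply: (@skeleton_pack_inj _ M).
  split; last by rewrite !labels_reverse_module.
  by move=> x xM; rewrite -!(skeleton_reverse_module _).1.
rewrite !pack_reverse_module labels_reverse_module.
by apply/ffunP=> x; rewrite !ffunE reverse_labelK.
Qed.

(** Across the boundary of [M], the new label is the old label of some element of [M], which
    autonomy relates in the same way. Inside [M], order and labels are both reversed. *)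
Lemma reverse_module_tableau q T : tableau q r T -> tableau q r' (reverse_module T).
Proof.
move=> [T0 inc]; split=> [x|x y].
  case: (boolP (x \in M)) => xM; last by rewrite ffunE (negPf xM).
  by have /labelsP[z _ <-] := mem_reverse_module T xM.
case: (boolP (x \in M)) => xM; last first.
  rewrite flipEl // [reverse_module T x]ffunE (negPf xM).
  case: (boolP (y \in M)) => yM; last by rewrite ffunE (negPf yM); apply: inc.
  have /labelsP[z zM <-] := mem_reverse_module T yM.
  by rewrite (aut yM zM xM).2; apply: inc.
case: (boolP (y \in M)) => yM; last first.
  rewrite flipEr // [reverse_module T y]ffunE (negPf yM).
  have /labelsP[z zM <-] := mem_reverse_module T xM.
  by rewrite (aut xM zM yM).1; apply: inc.
rewrite /r' /flip /subst_rel xM yM => /inc.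
have sS := labels_sorted M T; have Tx := mem_labels T xM; have Ty := mem_labels T yM.
rewrite -(index_ltn_sorted sS Ty Tx).
rewrite -(index_ltn_sorted sS (mem_reverse_module T xM) (mem_reverse_module T yM)).
rewrite !index_reverse_module // /reverse_label.
move: Tx Ty; rewrite -!index_mem => Tx Ty; rewrite Tx Ty.
by move: (index (T x) _) (index (T y) _) (size _) Tx Ty => a b c; lia.
Qed.

End FlipDynamics.

(** * Transfer of periods along flips *)

Section PromotionEquivalence.

Context {V : finType} (q : nat).
Implicit Types (r s : rel V) (T : {ffun V -> nat}).

(** An injection suffices, because having the same comparability graph is symmetric and gives an
    embedding in the other direction as well. *)
Definition embeds_periods r s := exists rho : {ffun V -> nat} -> {ffun V -> nat},
  [/\ forall T, tableau q r T -> tableau q s (rho T),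
      injective rho
    & forall T t, tableau q r T ->
        iter t (promotion q s) (rho T) = rho T <-> iter t (promotion q r) T = T].

Lemma eq_embeds_periods r s : r =2 s -> embeds_periods r s.
Proof.
move=> rs; exists id; split=> // [T [T0 inc]|T t _].
  by split=> // x y; rewrite -rs; apply: inc.
by rewrite (eq_iter (fun U => eq_promotion q U rs)).
Qed.

Lemma embeds_periods_trans r s t :
  embeds_periods r s -> embeds_periods s t -> embeds_periods r t.
Proof.
move=> [f [ft fi fp]] [g [gt gi gp]]; exists (g \o f); split.
- by move=> T /ft/gt.
- exact: inj_comp.
- by move=> T u tT; rewrite gp ?fp //; apply: ft.
Qed.

Lemma embeds_periods_flip M r : 0 < q -> autonomous M r -> embeds_periods r (flip M r).
Proof.
move=> q0 aut; exists (reverse_module M); split.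
- exact: reverse_module_tableau.
- exact/inv_inj/reverse_moduleK.
- move=> T t tT; apply: iter_promotion_flip => //.
  + exact: reverse_module_tableau.
  + exact: skeleton_reverse_module.
  + exact: pack_reverse_module.
Qed.

Lemma same_comparability_embeds_periods r s : 0 < q ->
  strict_order r -> strict_order s -> same_comparability r s -> embeds_periods r s.
Proof.
move=> q0 ro so rs.
apply: (flip_induction eq_embeds_periods embeds_periods_trans _ ro so rs (X := setT)).
- by move=> M t _; apply: embeds_periods_flip.
- by move=> x y z; rewrite !inE.
- by move=> x y; rewrite !inE.
Qed.

End PromotionEquivalence.

(** * K-promotion as a product of K-Bender-Knuth involutions *)

Section KPromotionBenderKnuth.

Context {d : Order.disp_t} (P : finPOrderType d) (q : nat).
Hypothesis q0 : 0 < q.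
Implicit Types (T : labeling P q) (x y z : P) (i : 'I_q.+1).

Local Notation ltP := (fun x y : P => (x < y)%O).

(* Once K-promotion has treated the labels 2, ..., j, the moving label 1 takes
   the place of j and the labels 2, ..., j that of 1, ..., j - 1. *)
Definition relabel (j v : nat) : nat :=
  if v == 1 then j else if v <= j then v.-1 else v.

Definition relabeled (j : nat) T : {ffun P -> nat} := [ffun x => relabel j (T x)].

Lemma val_one : Defs.one q = 1 :> nat.
Proof. by rewrite inordK. Qed.

Lemma component_gt1 T i x :
  (1 < #|component T i x|) =
  [exists y, [&& x \in labeled T i, y \in labeled T i & hasse x y]].
Proof.
apply/idP/existsP => [/card_gt1P[y [z [yc zc yz]]]|[y xy]].
  have [w wc wx] : exists2 w, w \in component T i x & w != x.
    by have [yx|yx] := eqVneq y x; [exists z; rewrite // -yx eq_sym | exists y].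
  move: wc; rewrite inE => /connectP[[|v p] /= pth wE]; first by rewrite wE eqxx in wx.
  by have /andP[xv _] := pth; exists v.
have xx : x \in component T i x by rewrite inE connect0.
have yx : y \in component T i x by rewrite inE connect1.
apply/card_gt1P; exists x, y; split=> //; apply: contraTneq xy => <-.
by rewrite /hasse /cover_rel /= Order.POrderTheory.ltxx /= !andbF.
Qed.

Lemma relabel_eq_low j v : 0 < j -> (relabel j v == j) = (v == 1).
Proof. by rewrite /relabel => j0; case: (v =P 1) => v1; [rewrite eqxx | case: leqP; lia]. Qed.

Lemma relabel_eq_high j v : 0 < j -> (relabel j v == j.+1) = (v == j.+1).
Proof.
by rewrite /relabel => j0; case: (v =P 1) => v1; [lia | case: leqP; lia].
Qed.

(** The labels 1 and [i] read as [j] and [j.+1] before the step, but as [j.+1] and [j] after it.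
    Hence a swap leaves the relabelled value unchanged, while an isolated element changes it, as in
    [bk]. *)
Lemma kstep_bk T i (j := i.-1) : 1 < i -> increasing ltP (relabeled j T) ->
  relabeled i (kstep T i) = bk ltP j (relabeled j T).
Proof.
move=> i1; have ij : i = j.+1 :> nat by rewrite prednK // ltnW.
have j0 : 0 < j by lia.
set m := relabeled j T => inc.
have m_low x : (m x == j) = (T x == Defs.one q).
  by rewrite ffunE relabel_eq_low // -val_eqE /= val_one.
have m_high x : (m x == j.+1) = (T x == i).
  by rewrite ffunE relabel_eq_high // -val_eqE /= ij.
have inL x : (x \in labeled T i) = (m x == j) || (m x == j.+1).
  by rewrite inE m_low m_high.
(* No label fits strictly between [j] and [j.+1], so the relation is a cover. *)
have edge x y : (x < y)%O -> m x = j -> m y = j.+1 -> hasse x y && hasse y x.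
  move=> xy mx my; rewrite /hasse /cover_rel /= xy /=.
  suff -> : [exists z, (x < z)%O && (z < y)%O] = false by rewrite orbT.
  apply/existsP=> -[z /andP[/inc + /inc]]; rewrite mx my.
  by move: (m z) => v; lia.
have hasse_lt x y : hasse x y -> (x < y)%O || (y < x)%O.
  by rewrite /hasse /cover_rel /= => /orP[/andP[-> _]|/andP[-> _]] //; rewrite orbT.
apply/ffunP=> x; rewrite [LHS]ffunE ffunE [RHS]ffunE component_gt1.
case: (m x =P j) => [mx|/eqP nlow].
  have -> : [exists y, [&& x \in labeled T i, y \in labeled T i & hasse x y]]
          = [exists y, (x < y)%O && (m y == j.+1)].
    apply: eq_existsb => y; rewrite !inL mx eqxx /=; apply/andP/andP.
      case=> my /hasse_lt/orP[xy|/inc]; last by case/orP: my => /eqP->; rewrite mx; lia.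
      by split=> //; have := inc _ _ xy; case/orP: my => /eqP my; rewrite my mx ?ltnn.
    by case=> xy /eqP my; rewrite my eqxx orbT; case/andP: (edge x y xy mx my).
  have Tx : T x = Defs.one q by apply/eqP; rewrite -m_low mx.
  rewrite Tx tpermL; case: [exists y, _]; rewrite /relabel /= ?val_one ?eqxx //.
  by rewrite ifF ?leqnn //; apply/eqP; lia.
case: (m x =P j.+1) => [mx|/eqP nhigh].
  have -> : [exists y, [&& x \in labeled T i, y \in labeled T i & hasse x y]]
          = [exists y, (y < x)%O && (m y == j)].
    apply: eq_existsb => y; rewrite !inL mx eqxx orbT /=; apply/andP/andP.
      case=> my /hasse_lt/orP[/inc|yx]; first by case/orP: my => /eqP->; rewrite mx; lia.
      by split=> //; have := inc _ _ yx; case/orP: my => /eqP my; rewrite my mx ?ltnn.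
    by case=> yx /eqP my; rewrite my eqxx; case/andP: (edge y x yx my mx).
  have Tx : T x = i by apply/eqP; rewrite -m_high mx.
  rewrite Tx tpermR; case: [exists y, _]; rewrite /relabel /= ?val_one ?eqxx //.
  by rewrite ifF ?leqnn //; apply/eqP; lia.
have xL : x \notin labeled T i by rewrite inL negb_or nlow.
rewrite ifF; last by apply/existsP=> -[y]; rewrite (negPf xL).
rewrite ffunE; move: nlow nhigh; rewrite !ffunE /relabel.
rewrite ij; move: (T x : nat) => v.
by case: (v =P 1) => [_|_]; rewrite ?eqxx //; case: (leqP v j); case: (leqP v j.+1); lia.
Qed.

Definition nat_labeling T : {ffun P -> nat} := [ffun x => T x : nat].

Lemma nat_labeling_inj : injective nat_labeling.
Proof.
move=> T U eqTU; apply/ffunP=> x; apply: val_inj.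
by have := congr1 (fun f : {ffun P -> nat} => f x) eqTU; rewrite !ffunE.
Qed.

Lemma mem_Inc T : T \in Inc P q <-> tableau q ltP (nat_labeling T).
Proof.
rewrite inE; split=> [/andP[/forallP T0 /forallP Tinc]|[T0 Tinc]].
  split=> [x|x y xy]; first by rewrite ffunE T0 /= -ltnS.
  by rewrite !ffunE; have /forallP/(_ y)/implyP/(_ xy) := Tinc x.
apply/andP; split; apply/forallP=> x; first by have := T0 x; rewrite ffunE => /andP[].
by apply/forallP=> y; apply/implyP=> /Tinc; rewrite !ffunE.
Qed.

Lemma nat_labeling_kpromotion T : T \in Inc P q ->
  nat_labeling (kpromotion T) = promotion q ltP (nat_labeling T).
Proof.
move=> /mem_Inc tT; have [T0 inc] := tT.
pose s := [seq i : 'I_q.+1 <- enum 'I_q.+1 | (1 < i)].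
have Es : map val s = iota 2 q.-1.
  have -> : s = filter (preim val (fun j => 1 < j)) (enum 'I_q.+1) by [].
  rewrite -filter_map val_enum_ord.
  case: (q) q0 => // n _; rewrite /= (@eq_in_filter _ _ predT) ?filter_predT //.
  by move=> j; rewrite mem_iota => /andP[->].
have gen (l : seq 'I_q.+1) U k : map val l = iota k.+1 (size l) -> 0 < k ->
    increasing ltP (relabeled k U) ->
    relabeled (k + size l) (foldl (@kstep _ P q) U l) = bks ltP (iota k (size l)) (relabeled k U).
  elim: l U k => [|i l IHl] U k /=; first by rewrite addn0.
  case=> ik El k0 Uk; have ki : k = i.-1 by rewrite ik.
  rewrite addnS -addSn -ik; have step : relabeled i (kstep U i) = bk ltP k (relabeled k U).
    by rewrite ki; apply: kstep_bk; rewrite -?ki // ik.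
  by rewrite IHl; [rewrite step ik | rewrite ik | rewrite ik | rewrite step; apply: bk_increasing].
have relabel1 : relabeled 1 T = nat_labeling T.
  by apply/ffunP=> x; rewrite !ffunE /relabel; case: eqP => [->|] //; case: leqP; lia.
have szs : size s = q.-1 by rewrite -(size_map val) Es size_iota.
have := gen s T 1; rewrite szs Es relabel1 add1n prednK // => /(_ erefl isT inc).
rewrite -/(promotion q _ _) => E; rewrite -E.
have [P0 _] := promotion_tableau tT.
(* On positive labels up to [q], the final shift is [relabel q]: 1 becomes [q] and the others drop
   by one. *)
apply/ffunP=> x; rewrite [LHS]ffunE [RHS]ffunE /kpromotion ffunE -/s.
have := P0 x; rewrite -E ffunE /relabel.
set v := foldl _ T s x; have := ltn_ord v; move: (nat_of_ord v) => {}v vq v0.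
have {}v0 : 0 < v by case: v v0 vq.
case: (v =P 1) => [->//|v1]; rewrite ifF; last by apply/eqP; lia.
by rewrite inordK; [rewrite ifT //|]; lia.
Qed.

End KPromotionBenderKnuth.

(** * Counting orbits *)

Section Pullback.

Context {V W : finType} (g : V -> W) (g' : W -> V).
Hypotheses (gK : cancel g g') (g'K : cancel g' g).
Implicit Types (r : rel W) (m : {ffun W -> nat}).

Definition pullback m : {ffun V -> nat} := [ffun x => m (g x)].

Lemma pullback_inj : injective pullback.
Proof.
move=> m m' eqm; apply/ffunP=> y.
by have := congr1 (fun f : {ffun V -> nat} => f (g' y)) eqm; rewrite !ffunE g'K.
Qed.

Lemma bk_pullback r i m : bk (relpre g r) i (pullback m) = pullback (bk r i m).
Proof.
apply/ffunP=> x; rewrite !ffunE.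
have exE (p : pred W) (p' : pred V) : (forall z, p' z = p (g z)) ->
    [exists z, p' z] = [exists y, p y].
  move=> pE; apply/existsP/existsP => -[z pz]; first by exists (g z); rewrite -pE.
  by exists (g' z); rewrite pE g'K.
rewrite (exE (fun y => r (g x) y && (m y == i.+1))); last by move=> z; rewrite ffunE.
by rewrite (exE (fun y => r y (g x) && (m y == i))) // => z; rewrite ffunE.
Qed.

Lemma promotion_pullback q r m :
  promotion q (relpre g r) (pullback m) = pullback (promotion q r m).
Proof.
rewrite /promotion; elim: (iota _ _) m => //= i l IHl m.
by rewrite bk_pullback IHl.
Qed.

Lemma tableau_pullback q r m : tableau q (relpre g r) (pullback m) <-> tableau q r m.
Proof.
split=> -[m0 inc]; last by split=> [x|x z /inc]; rewrite !ffunE.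
split=> [y|y z]; first by have := m0 (g' y); rewrite ffunE g'K.
by have := inc (g' y) (g' z); rewrite /= !ffunE !g'K.
Qed.

End Pullback.

Section Periods.

Context {T : finType} (f : T -> T) (S : {set T}).
Hypotheses (f_stable : {homo f : x / x \in S}) (f_inj : {in S &, injective f}).

Lemma iter_eq_dvdn x t : x \in S -> iter t f x = x <-> order f x %| t.
Proof.
move=> xS; have fix_mul n : iter (n * order f x) f x = x.
  by elim: n => // n IHn; rewrite mulSn iterD IHn (iter_order_in f_stable f_inj).
split=> [|/dvdnP[n ->]] //.
rewrite {1}(divn_eq t (order f x)) addnC iterD fix_mul => fixr.
have := findex_iter (ltn_pmod t (order_gt0 f x)).
by rewrite fixr findex0 /dvdn => <-.
Qed.

Lemma mem_orbit_in x y : x \in S -> y \in orbit f x ->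
  y \in S /\ [set z in orbit f y] = [set z in orbit f x].
Proof.
move=> xS; rewrite -fconnect_orbit => xy.
have yS : y \in S.
  by rewrite -(iter_findex xy); elim: (findex f x y) => //= n; apply: f_stable.
split=> //; apply/setP=> z; rewrite !inE -!fconnect_orbit.
apply/idP/idP; first exact: connect_trans.
by apply: connect_trans; rewrite (fconnect_sym_in f_stable f_inj).
Qed.

Let orb x := [set y in orbit f x].

Lemma card_orbit_set x : #|orb x| = order f x.
Proof. by rewrite cardsE (card_uniqP (orbit_uniq f x)) size_orbit. Qed.

(** The orbits of size [n] partition the elements of order [n]. This converts counts of tableaux,
    which an injection compares, into counts of orbits. *)
Lemma card_orbits_of_size n :
  #|[set x in S | order f x == n]| = #|[set O in orb @: S | #|O| == n]| * n.
Proof.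
apply: card_uniform_partition => [O|]; first by rewrite inE => /andP[_ /eqP].
have self x : x \in orb x by rewrite inE -fconnect_orbit connect0.
apply/and3P; split.
- apply/eqP/setP=> x; apply/bigcupP/idP.
    case=> _ /setIdP[/imsetP[y yS ->] /eqP yn]; rewrite [x \in _]inE => xy; have [xS xyE] := mem_orbit_in yS xy.
    by rewrite inE xS -card_orbit_set /orb xyE yn /=.
  rewrite inE => /andP[xS /eqP xn]; exists (orb x) => //.
  by rewrite inE imset_f // card_orbit_set xn /=.
- apply/trivIsetP=> _ _ /setIdP[/imsetP[x xS ->] _] /setIdP[/imsetP[y yS ->] _].
  apply: contraNT => /pred0Pn[z]; rewrite /= !inE => /andP[zx zy].
  by rewrite /orb -(mem_orbit_in xS zx).2 -(mem_orbit_in yS zy).2.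
- apply/negP => /setIdP[/imsetP[x xS]] x0.
  by have := self x; rewrite -x0 inE.
Qed.

End Periods.

(** The classes of equal weight are enumerated on both sides and matched position by position. *)
Lemma bijection_of_class_cards (A B : finType) (K : {set A}) (L : {set B})
    (w : A -> nat) (w' : B -> nat) (b0 : B) :
  (forall n, #|[set a in K | w a == n]| = #|[set b in L | w' b == n]|) ->
  exists f : A -> B, [/\ {in K &, injective f}, [set f a | a in K] = L
    & {in K, forall a, w' (f a) = w a}].
Proof.
move=> cards; pose Kn n := enum [set a in K | w a == n].
pose Ln n := enum [set b in L | w' b == n].
have size_n n : size (Kn n) = size (Ln n) by rewrite -!cardE.
have memK a : a \in K -> a \in Kn (w a) by move=> aK; rewrite mem_enum inE aK /=.
(* On [K] the default [b0] is never reached, since matching classes have the same size. *)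
pose f a := nth b0 (Ln (w a)) (index a (Kn (w a))).
have fL a : a \in K -> f a \in Ln (w a).
  by move=> aK; rewrite mem_nth // -size_n index_mem memK.
have wf a : a \in K -> w' (f a) = w a.
  by move=> /fL; rewrite mem_enum inE => /andP[_ /eqP].
exists f; split=> // [a a' aK a'K eqf|].
  have ww' : w a = w a' by rewrite -wf // eqf wf.
  have a'Ka : a' \in Kn (w a) by rewrite ww' memK.
  move/eqP: eqf; rewrite /f -ww' nth_uniq ?enum_uniq -?size_n ?index_mem ?memK //.
  by move/eqP/(index_inj a); apply; rewrite ?memK.
apply/setP=> b; apply/imsetP/idP => [[a /fL + ->]|bL].
  by rewrite mem_enum inE => /andP[].
have bLn : b \in Ln (w' b) by rewrite mem_enum inE bL /=.
have := bLn; rewrite -index_mem -size_n.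
case E : (Kn (w' b)) => [//|a0 s]; rewrite -E => lt.
have := mem_nth a0 lt; set a := nth _ _ _ => aKn.
have /andP[aK /eqP wa] : (a \in K) && (w a == w' b) by rewrite mem_enum inE in aKn.
exists a => //; rewrite /f wa index_uniq ?enum_uniq // nth_index //.
Qed.

(** The order of [Q] is pulled back along the graph isomorphism, which yields two orders on [P] with
    the same comparability graph. *)
Lemma comparability_embeds_Inc (d d' : Order.disp_t) (P : finPOrderType d)
    (Q : finPOrderType d') (q : nat) : 0 < q -> comparability_isomorphic P Q ->
  exists h : labeling P q -> labeling Q q,
    [/\ {in Inc P q, forall T, h T \in Inc Q q}, {in Inc P q &, injective h} &
        {in Inc P q, forall T, order (@kpromotion _ Q q) (h T) = order (@kpromotion _ P q) T}].
Proof.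
move=> q0 [g [g' gK g'K] gcomp].
pose r : rel P := fun x y => (x < y)%O; pose s : rel Q := fun x y => (x < y)%O.
have so (d0 : Order.disp_t) (R : finPOrderType d0) :
    strict_order (fun x y : R => (x < y)%O).
  split=> [x|y x z]; [exact: Order.POrderTheory.ltxx | exact: Order.POrderTheory.lt_trans].
have compE (d0 : Order.disp_t) (R : finPOrderType d0) (x y : R) :
    comparability x y = (x < y)%O || (y < x)%O.
  rewrite /comparability /= /Order.comparable !Order.POrderTheory.le_eqVlt (eq_sym y).
  by case: eqVneq => [->|] //=; rewrite Order.POrderTheory.ltxx.
have rs : same_comparability r (relpre g s).
  by move=> x y; rewrite /r /s /= -!compE gcomp.
have so' : strict_order (relpre g s).
  by have [irr tr] := so _ Q; split=> [x|y x z]; [apply: irr | apply: tr].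
have [rho [rho_tab rho_inj rho_per]] :=
  same_comparability_embeds_periods q0 (so _ P) so' rs.
(* [inord] loses nothing when [T] is in [Inc P q], as the values of [rho] are then at most [q]. *)
pose h (T : labeling P q) : labeling Q q :=
  [ffun y => inord (rho (nat_labeling T) (g' y))].
have hE T : T \in Inc P q -> pullback g (nat_labeling (h T)) = rho (nat_labeling T).
  move=> /mem_Inc/rho_tab[T0 _]; apply/ffunP=> x; rewrite !ffunE gK inordK //.
  by have /andP[_] := T0 x; rewrite ltnS.
have hInc T : T \in Inc P q -> h T \in Inc Q q.
  move=> TI; apply/mem_Inc/(tableau_pullback g'K); rewrite hE //.
  exact/rho_tab/mem_Inc.
have iterE (d0 : Order.disp_t) (R : finPOrderType d0) (U : labeling R q) t : U \in Inc R q ->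
    iter t (@kpromotion _ R q) U \in Inc R q /\
    nat_labeling (iter t (@kpromotion _ R q) U) =
    iter t (promotion q (fun x y : R => (x < y)%O)) (nat_labeling U).
  move=> UI; elim: t => //= t [IH1 IH2]; split; first exact: kpromotion_Inc.
  by rewrite nat_labeling_kpromotion // IH2.
have pull_iter m t : pullback g (iter t (promotion q s) m) =
    iter t (promotion q (relpre g s)) (pullback g m).
  by elim: t => //= t <-; rewrite (promotion_pullback g'K).
exists h; split=> // [T U TI UI eqh|T TI].
  by apply/nat_labeling_inj/rho_inj; rewrite -!hE // eqh.
have same t : iter t (@kpromotion _ Q q) (h T) = h T <-> iter t (@kpromotion _ P q) T = T.
  have [_ EQ] := iterE _ _ _ t (hInc T TI); have [_ EP] := iterE _ _ _ t TI.
  have /mem_Inc tT := TI; have per := rho_per _ t tT.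
  split=> fixed.
    apply: nat_labeling_inj; rewrite EP; apply/per.
    by rewrite -hE // -pull_iter -EQ fixed.
  apply/nat_labeling_inj/(pullback_inj g'K); rewrite EQ pull_iter hE //.
  by apply/per; rewrite -EP fixed.
have dvd (d0 : Order.disp_t) (R : finPOrderType d0) (U : labeling R q) t : U \in Inc R q ->
    iter t (@kpromotion _ R q) U = U <-> order (@kpromotion _ R q) U %| t.
  by apply: iter_eq_dvdn; [move=> ?; apply: kpromotion_Inc | apply: kpromotion_inj].
(* Iterates fixing [T] and [h T] have the same exponents, so the two orders divide each other. *)
apply/eqP; rewrite eqn_dvd; apply/andP; split.
  by apply/(dvd _ _ _ _ (hInc T TI))/same/(dvd _ _ _ _ TI).
by apply/(dvd _ _ _ _ TI)/same/(dvd _ _ _ _ (hInc T TI)).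
Qed.

Lemma comparability_isomorphic_sym (d d' : Order.disp_t) (P : finPOrderType d)
    (Q : finPOrderType d') : comparability_isomorphic P Q -> comparability_isomorphic Q P.
Proof.
case=> g [g' gK g'K] gcomp; exists g'; first by exists g.
by move=> x y; rewrite -gcomp !g'K.
Qed.

(** The factor [n] appears because the injection compares the tableaux lying in orbits of size
    [n]. *)
Lemma card_korbits_le (d d' : Order.disp_t) (P : finPOrderType d)
    (Q : finPOrderType d') (q n : nat) : 0 < q -> comparability_isomorphic P Q ->
  #|[set O in korbits P q | #|O| == n]| * n <= #|[set O in korbits Q q | #|O| == n]| * n.
Proof.
move=> q0 PQ; have [h [hI h_inj h_ord]] := comparability_embeds_Inc q0 PQ.
have orbitsE (d0 : Order.disp_t) (R : finPOrderType d0) :=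
  card_orbits_of_size (fun T => @kpromotion_Inc _ R q T q0) (@kpromotion_inj _ R q q0) n.
rewrite -!orbitsE -(card_in_imset (f := h)); last first.
  by move=> T U /setIdP[TI _] /setIdP[UI _]; apply: h_inj.
apply/subset_leq_card/subsetP=> _ /imsetP[T /setIdP[TI Tn] ->].
by rewrite inE hI // h_ord.
Qed.

Theorem theorem5p1 (d d' : Order.disp_t) (P : finPOrderType d)
    (Q : finPOrderType d') (q : nat) (hq : 0 < q)
    (hPQ : comparability_isomorphic P Q) :
  exists f : {set labeling P q} -> {set labeling Q q},
    [/\ {in korbits P q &, injective f},
        [set f O | O in korbits P q] = korbits Q q
      & {in korbits P q, forall O, #|f O| = #|O|}].
Proof.
apply: (bijection_of_class_cards (w := fun O : {set labeling P q} => #|O|)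
  (w' := fun O : {set labeling Q q} => #|O|) set0) => -[|n].
  (* Size 0 is separate, since the factor cannot be cancelled there; no orbit is empty. *)
  suff none (d0 : Order.disp_t) (R : finPOrderType d0) :
      #|[set O in korbits R q | #|O| == 0]| = 0 by rewrite !none.
  apply/eqP; rewrite cards_eq0; apply/eqP/setP=> O; rewrite !inE.
  apply/negP => /andP[/imsetP[T _ ->]]; rewrite cards_eq0 => /eqP/setP/(_ T).
  by rewrite !inE -fconnect_orbit connect0.
apply/eqP; rewrite -(eqn_pmul2r (ltn0Sn n)) eqn_leq !card_korbits_le //.
exact: comparability_isomorphic_sym.
Qed.
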